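(* There are absolute constants $c>0$ and $C>0$ such that the following holds. Let $p$ be a prime. Let $A$ be a set of generators of $G=\operatorname{SL}_2(\mathbb{Z}/p\mathbb{Z})$. Let $\psi$ be a symmetric probability distribution on $G$ whose support contains $A$, and let $\eta=\min_{g\in A\cup A^{-1}}\psi(g)$. Then the second largest eigenvalue of $T_\psi(G,A)$ is at most $$1-\frac{C\,\eta}{(\log p)^{2c}}.$$
   Context: A probability distribution $\psi$ on $G$ is symmetric if $\psi(g)=\psi(g^{-1})$ for every $g\in G$. The transition matrix is $T_\psi(G,A)=\{\psi(y^{-1}x)\}_{x,y\in G}$, a real symmetric matrix whose largest eigenvalue is $1$; eigenvalues are counted with multiplicity. *)

(* Defs.v *)
From HB Require Import structures.
From mathcomp Require Import all_boot all_order all_fingroup all_algebra.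
From mathcomp Require Import polyrcf.
From mathcomp Require Import reals exp.

Set Implicit Arguments.
Unset Strict Implicit.
Unset Printing Implicit Defensive.

Import Order.TTheory GRing.Theory Num.Theory.
Local Open Scope ring_scope.

Definition SL2_set (p : nat) : {set {'GL_2['F_p]}} :=
  [set u : {'GL_2['F_p]} | \det (GLval u) == 1].

Lemma SL2_group_set (p : nat) : group_set (SL2_set p).
Proof.
apply/group_setP; split=> [|u v]; first by rewrite inE GL_1E det1.
by rewrite !inE GL_ME det_mulmx => /eqP -> /eqP ->; rewrite mulr1.
Qed.

Canonical SL2_group (p : nat) : {group {'GL_2['F_p]}} :=
  Group (SL2_group_set p).

(* For p prime, 'F_p is Z/pZ; [subg _] turns the subgroup into a group type. *)
Definition SL2 (p : nat) : finGroupType := [subg SL2_group p].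

Section RandomWalk.
Variables (R : realType) (gT : finGroupType).

Definition is_distribution (psi : gT -> R) : Prop :=
  (forall g, 0 <= psi g) /\ \sum_(g : gT) psi g = 1.

Definition symmetric_fun (psi : gT -> R) : Prop :=
  forall g, psi g = psi (g^-1)%g.

Definition fun_support (psi : gT -> R) : {set gT} := [set g | psi g != 0].

(* The default value 1 is neutral: a distribution takes values in [0, 1], so this is
   the minimum of psi over A :|: A^-1 as soon as A is nonempty. *)
Definition min_weight (psi : gT -> R) (A : {set gT}) : R :=
  \big[Num.min/1]_(g in A :|: A^-1%g) psi g.

(* Rows and columns are indexed by the group through its enumeration. *)
Definition transition_matrix (psi : gT -> R) : 'M[R]_#|gT| :=
  \matrix_(i, j) psi ((enum_val j)^-1 * enum_val i)%g.

End RandomWalk.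

(* Real eigenvalues in nonincreasing order, each repeated according to its
   multiplicity as a root of the characteristic polynomial. For a symmetric
   matrix of size n these are all n eigenvalues. *)
Definition eigenvalues (R : realType) (n : nat) (M : 'M[R]_n) : seq R :=
  sort (fun x y => y <= x)
    (flatten [seq nseq (mup a (char_poly M)) a | a <- rootsR (char_poly M)]).

Definition second_largest_eigenvalue (R : realType) (n : nat) (M : 'M[R]_n) : R :=
  nth 0 (eigenvalues M) 1.

(* Main.v *)
Require Import Defs.
From mathcomp Require Import all_boot all_order all_fingroup all_algebra.
From mathcomp Require Import polyrcf.
From mathcomp Require Import reals exp.
From mathcomp Require Import ring lra zify.

(* Let [G = SL_2(F)], [A] a symmetric generating set containing 1, [N = |A|] and
   [M = |A^24|]. If [A] is neither bounded nor almost all of [G] then [A] grows: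
   [M >= N^(32/31)].
   - Some [x] in [A^4] has trace outside [{0, 2, -2}]: the traces of [g x_i], for a basis
     [x_i] of the 2 x 2 matrices taken in [A^3], determine [g].
   - (Larsen-Pink) For such a trace [s], [X = {x in B | tr x = s}] satisfies
     [|X|^3 << |B^4|^2]: the map [(x1, x2, x3) |-> (x1^-1 x2, x1^-1 x3)] has fibres of size
     at most 2, except on triples of which two entries agree or the first two share a
     fixed line. By orbit-stabilizer a torus [C[z]] which contains such an element of [A^2]
     contains about [N^(1/3)] elements of [A^2].
   - (Pivoting) If [C[y]] is such a torus and [C[y^g]], [g] in [A], is not, the
     products [x t^g] with [x] in [A], [t] in [A^2], [t] in [C[y]], are almost all distinct, so
     [A^5] is large. Otherwise all conjugates of one torus are rich, and summing over the
     about [|F|^2] conjugates shows that [A] is almost all of [G].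
   - If [|A|^4 > 4 |F|^11], a point-line incidence bound shows that [A^10] contains the
     unipotent subgroups, hence [A^40 = G].
   Iterating, [A^d = G] with [d] polynomial in [log |F|]. For an eigenfunction [f] of
   eigenvalue [r] orthogonal to the constants, comparing the Dirichlet form along words of
   length [d] with the variance of [f] gives [1 - r >= eta / d^2]. *)

Set Implicit Arguments.
Unset Strict Implicit.
Unset Printing Implicit Defensive.
Import Order.TTheory GRing.Theory Num.Theory.

(** * Fibre counting and product sets *)

Lemma card_fibre_leq (T U : finType) (D : {set T}) (E : {set U}) (f : T -> U)
    (k : nat) :
  (forall x, x \in D -> f x \in E) ->
  (forall x0, x0 \in D -> #|[set x in D | f x == f x0]| <= k) ->
  #|D| <= k * #|E|.
Proof.
move=> DE fib.
rewrite -sum1_card (partition_big f (mem E)) //= mulnC -sum_nat_const.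
apply: leq_sum => y Ey; rewrite sum1dep_card.
case: (set_0Vmem [set x in D | f x == y]) => [->|[x0]]; first by rewrite cards0.
by rewrite inE => /andP[Dx0 /eqP <-]; apply: fib.
Qed.

Lemma card_fibre_geq (T U : finType) (D : {set T}) (E : {set U}) (f : T -> U)
    (k : nat) :
  (forall y, y \in E -> k <= #|[set x in D | f x == y]|) -> k * #|E| <= #|D|.
Proof.
move=> fib; rewrite mulnC -sum_nat_const -[#|D|]sum1_card.
rewrite (bigID (fun x => f x \in E)) /= (partition_big f (mem E)) /=; last first.
  by move=> x /andP[].
apply: leq_trans (leq_addr _ _); apply: leq_sum => y Ey.
apply: leq_trans (fib y Ey) _; rewrite sum1dep_card; apply/subset_leq_card/subsetP.
by move=> x; rewrite !inE => /andP[-> /eqP ->]; rewrite Ey eqxx.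
Qed.

Lemma card_inj_leq (T U : finType) (D : {set T}) (E : {set U}) (f : T -> U) :
  (forall x, x \in D -> f x \in E) -> {in D &, injective f} -> #|D| <= #|E|.
Proof.
move=> DE injf; rewrite -(card_in_imset injf); apply/subset_leq_card/subsetP.
by move=> _ /imsetP[x Dx ->]; apply: DE.
Qed.

Lemma card_leq2 (T : finType) (D : {set T}) (x0 x1 : T) :
  (forall x, x \in D -> x = x0 \/ x = x1) -> #|D| <= 2.
Proof.
move=> D01; apply: (@leq_trans #|[set x0; x1]|); last first.
  by rewrite cards2; case: (_ == _).
apply/subset_leq_card/subsetP => x /D01 [] ->; rewrite !inE eqxx ?orbT //.
Qed.

Section ProductSets.
Variable gT : finGroupType.
Implicit Types (A B : {set gT}) (x y : gT).
Local Open Scope group_scope.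

Lemma mem_expg_mul A m n x y :
  x \in A ^+ m -> y \in A ^+ n -> x * y \in A ^+ (m + n).
Proof. by move=> Ax Ay; rewrite expgnDr; apply: mem_mulg. Qed.

Lemma expg_sub_leq A m n : 1 \in A -> m <= n -> A ^+ m \subset A ^+ n.
Proof.
move=> A1 /subnKC <-; apply/subsetP => x Ax; rewrite -[x]mulg1.
apply: mem_expg_mul Ax _; elim: (n - m)%N => [|k IHk]; first by rewrite expg0 set11.
by rewrite -[1]mulg1 -addn1; apply: mem_expg_mul; rewrite ?expg1.
Qed.

Lemma sub_expg A n : 1 \in A -> 0 < n -> A \subset A ^+ n.
Proof. by move=> A1 n0; have := expg_sub_leq A1 n0; rewrite expg1. Qed.

Lemma expg_one_mem A n : 1 \in A -> 1 \in A ^+ n.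
Proof.
by move=> A1; apply: (subsetP (@expg_sub_leq A 0 n A1 _)); rewrite ?expg0 ?set11.
Qed.

Lemma expg_inv_mem A n x : A^-1 = A -> x \in A ^+ n -> x^-1 \in A ^+ n.
Proof.
move=> AV; elim: n x => [|n IHn] x; first by rewrite expg0 !inE invg_eq1.
rewrite expgSr => /mulsgP[y z Ay Az ->]; rewrite invMg -expgSr -add1n.
by apply: mem_expg_mul; rewrite ?IHn // expg1 -AV memV_invg.
Qed.

Lemma expg_symm A n : A^-1 = A -> (A ^+ n)^-1 = A ^+ n.
Proof.
move=> AV; apply/setP=> x; rewrite inE; apply/idP/idP; last exact: expg_inv_mem.
by move=> /(expg_inv_mem AV); rewrite invgK.
Qed.

Lemma gen_stable_set A (P : {set gT}) :
  <<A>> = [set: gT] -> 1 \in P ->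
  (forall x a, x \in P -> a \in A -> x * a \in P) -> P = [set: gT].
Proof.
move=> genA P1 PA; apply/setP => x; rewrite inE.
have : x \in <<A>> by rewrite genA inE.
move=> /gen_prodgP[n [c Ac ->]].
elim: n c Ac => [|n IHn] c Ac; first by rewrite big_ord0.
by rewrite big_ord_recr /=; apply: PA => //; apply: IHn => i.
Qed.

(** Finds a step at which a walk along generators leaves [P]. It is applied below to the stabilizer
    of a line and to the conjugators that keep a torus rich. *)
Lemma gen_escape A (P : {set gT}) x :
    <<A>> = [set: gT] -> 1 \in P -> x \notin P ->
  exists y a, [/\ y \in P, a \in A & y * a \notin P].
Proof.
move=> genA P1 NPx.
case: (boolP [exists y in P, [exists a in A, y * a \notin P]]).
  by case/exists_inP => y Py /exists_inP[a Aa NP]; exists y, a.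
move=> stab; case/negP: NPx; rewrite (gen_stable_set genA P1) ?inE // => y a Py Aa.
apply: contraR stab => NP; apply/exists_inP; exists y => //.
by apply/exists_inP; exists a.
Qed.

Lemma expg_stable A n :
  <<A>> = [set: gT] -> 1 \in A -> A ^+ n.+1 \subset A ^+ n -> A ^+ n = [set: gT].
Proof.
move=> genA A1 sub; apply: (gen_stable_set genA (expg_one_mem n A1)) => x a Ax Aa.
by apply: (subsetP sub); rewrite expgSr mem_mulg.
Qed.

(** The powers of [A] increase. Once two consecutive powers agree they are stable under right
    multiplication by generators, hence the whole group; until then every step gains an element. *)
Lemma expg_grow A n :
  <<A>> = [set: gT] -> 1 \in A -> A ^+ n = [set: gT] \/ n < #|A ^+ n|.
Proof.
move=> genA A1; elim: n => [|n [IHn|IHn]]; first by right; rewrite expg0 cards1.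
  left; apply/eqP; rewrite eqEsubset subsetT -IHn.
  exact: expg_sub_leq.
case: (boolP (A ^+ n.+1 \subset A ^+ n)) => sub.
  left; apply/eqP; rewrite eqEsubset subsetT.
  by rewrite -(expg_stable genA A1 sub); apply: expg_sub_leq.
right; apply: leq_ltn_trans IHn (proper_card _).
by rewrite properE sub expg_sub_leq.
Qed.

(* The products [x h] with [x] in [A], [h] in [H] cannot repeat more than
   [#|A^-1 A :&: H|] times. *)
Lemma card_subgroup_sqr A (H : {group gT}) (E : {set gT}) :
  A^-1 = A -> A * H \subset E ->
  (#|A| * #|H| <= #|A ^+ 2 :&: H| * #|E|)%N.
Proof.
move=> AV AHE; rewrite -cardsX.
apply: (@card_fibre_leq _ _ _ _ (fun u : gT * gT => u.1 * u.2)).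
  by case=> x h; rewrite inE /= => /andP[Ax Hh]; rewrite (subsetP AHE) ?mem_mulg.
case=> x0 h0; rewrite inE /= => /andP[Ax0 Hh0].
apply: (@card_inj_leq _ _ _ _ (fun u => x0^-1 * u.1)).
  case=> x h; rewrite !inE /= -andbA => /and3P[Ax Hh /eqP eq_xh].
  have Ax0V : x0^-1 \in A by rewrite -AV memV_invg.
  rewrite [A ^+ 2]expgS expg1 mem_mulg //=.
  have -> : x0^-1 * x = h0 * h^-1.
    by apply: (mulIg h); apply: (mulgI x0); rewrite !mulgA mulgKV mulgV mul1g.
  by rewrite groupM ?groupV.
case=> x h [y k]; rewrite !inE /= -!andbA.
move=> /and3P[_ _ /eqP exh] /and3P[_ _ /eqP eyk] /mulgI exy.
by congr pair => //; apply: (mulgI x); rewrite exh -eyk exy.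
Qed.
End ProductSets.

(** * Coordinates and centralizers *)

Local Open Scope ring_scope.

(* [apply: (lin_comb e)] proves an equation from a combination [e] of known equations,
   built with the three notations below, up to [ring]. *)
Lemma lin_comb (R : zmodType) (x y u v : R) : u = v -> x - y = u - v -> x = y.
Proof. by move=> -> /eqP; rewrite subrr subr_eq0 => /eqP. Qed.

Local Notation "k *! e" := (congr1 ( *%R k) e) (at level 40, left associativity).
Local Notation "e +! f" := (f_equal2 +%R e f) (at level 50, left associativity).
Local Notation "e (-) f" := (f_equal2 (fun u v => u - v) e f)
  (at level 50, left associativity).

(** The equations say that the cross product of [u] and [v] vanishes; [k] is read off at a nonzero
    coordinate of [u]. *)
Lemma parallel3 (F : fieldType) (u1 u2 u3 v1 v2 v3 : F) :
    ~~ [&& u1 == 0, u2 == 0 & u3 == 0] ->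
    v1 * u2 = v2 * u1 -> v1 * u3 = v3 * u1 -> v2 * u3 = v3 * u2 ->
  exists k, [/\ v1 = k * u1, v2 = k * u2 & v3 = k * u3].
Proof.
move=> u0 e12 e13 e23.
have [u10|u10] := eqVneq u1 0; last first.
  exists (v1 / u1); rewrite divfK //.
  by split=> //; apply: (mulIf u10); rewrite mulrAC divfK // ?e12 ?e13.
have [u20|u20] := eqVneq u2 0; last first.
  exists (v2 / u2); rewrite divfK //.
  by split=> //; apply: (mulIf u20); rewrite mulrAC divfK // -?e12 ?e23.
have u30 : u3 != 0 by move: u0; rewrite u10 u20 !eqxx.
exists (v3 / u3); rewrite divfK //.
by split=> //; apply: (mulIf u30); rewrite mulrAC divfK // -?e13 -?e23.
Qed.

(* [SL_2(F)] as an abstract group with four coordinate functions, so that matrix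
   identities become polynomial identities. *)
Record sl2_coords (F : finFieldType) (gT : finGroupType) := Sl2Coords {
  ea : gT -> F; eb : gT -> F; ec : gT -> F; ed : gT -> F;
  sl2_det : forall g, ea g * ed g = 1 + eb g * ec g;
  sl2_aM : forall g h, ea (g * h)%g = ea g * ea h + eb g * ec h;
  sl2_bM : forall g h, eb (g * h)%g = ea g * eb h + eb g * ed h;
  sl2_cM : forall g h, ec (g * h)%g = ec g * ea h + ed g * ec h;
  sl2_dM : forall g h, ed (g * h)%g = ec g * eb h + ed g * ed h;
  sl2_inj : forall g h, ea g = ea h -> eb g = eb h -> ec g = ec h ->
    ed g = ed h -> g = h;
  sl2_surj : forall a b c d, a * d = 1 + b * c ->
    exists g, [/\ ea g = a, eb g = b, ec g = c & ed g = d];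
  sl2_two_neq0 : (2 : F) != 0 }.

Section Coordinates.
Variables (F : finFieldType) (gT : finGroupType) (co : sl2_coords F gT).
Let two_neq0 := sl2_two_neq0 co.
Implicit Types (x y z : gT) (s t : F).

Let a := ea co. Let b := eb co. Let c := ec co. Let d := ed co.

Definition sl2_tr x := ea co x + ed co x.
Definition sl2_h x := ea co x - ed co x.
Let tr := sl2_tr.
Let h := sl2_h.

Lemma sl2_M x y : prod (prod (a (x * y)%g = a x * a y + b x * c y)
    (b (x * y)%g = a x * b y + b x * d y))
  (prod (c (x * y)%g = c x * a y + d x * c y)
    (d (x * y)%g = c x * b y + d x * d y)).
Proof. by rewrite /a /b /c /d sl2_aM sl2_bM sl2_cM sl2_dM. Qed.

Lemma sl2_1 : prod (prod (a 1%g = 1) (b 1%g = 0)) (prod (c 1%g = 0) (d 1%g = 1)).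
Proof.
have [|e [ae be ce de]] := @sl2_surj _ _ co 1 0 0 1; first by ring.
suff <- : e = 1%g by rewrite /a /b /c /d ae be ce de.
apply: (mulIg e); rewrite mul1g; apply: (@sl2_inj _ _ co);
  by rewrite ?sl2_aM ?sl2_bM ?sl2_cM ?sl2_dM ?ae ?be ?ce ?de; ring.
Qed.

Lemma sl2_V x : prod (prod (a x^-1%g = d x) (b x^-1%g = - b x))
  (prod (c x^-1%g = - c x) (d x^-1%g = a x)).
Proof.
have D := sl2_det co x; have D' : d x * a x = 1 + (- b x) * (- c x).
  by rewrite /a /b /c /d; ring: D.
have [y [ay by_ cy dy]] := @sl2_surj _ _ co _ _ _ _ D'.
suff -> : x^-1%g = y by rewrite /a /b /c /d ay by_ cy dy.
apply/eqP; rewrite eq_invg_mul; apply/eqP.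
have [[a1 b1] [c1 d1]] := sl2_1; rewrite /a /b /c /d in D a1 b1 c1 d1.
by apply: (@sl2_inj _ _ co); rewrite ?sl2_aM ?sl2_bM ?sl2_cM ?sl2_dM ?ay ?by_ ?cy ?dy
  ?a1 ?b1 ?c1 ?d1 /a /b /c /d; ring: D.
Qed.

Lemma sl2_trV x : tr x^-1%g = tr x.
Proof. by have := sl2_V x; rewrite /a /d /tr /sl2_tr => V; rewrite !V; ring. Qed.

Lemma sl2_trC x y : tr (x * y)%g = tr (y * x)%g.
Proof.
have Mxy := sl2_M x y; have Myx := sl2_M y x; rewrite /tr /sl2_tr -/a -/d Mxy Myx. 
by rewrite Mxy Myx; ring.
Qed.

Lemma sl2_trJ x y : tr (x ^ y)%g = tr x.
Proof. by rewrite conjgE sl2_trC mulgK. Qed.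

Lemma sl2_vec_inj x y :
  tr x = tr y -> h x = h y -> b x = b y -> c x = c y -> x = y.
Proof.
rewrite /tr /h /sl2_tr /sl2_h => et eh eb ec; apply: (@sl2_inj _ _ co) => //.
  by apply: (mulfI two_neq0); apply: (lin_comb (et +! eh)); ring.
by apply: (mulfI two_neq0); apply: (lin_comb (et (-) eh)); ring.
Qed.

(** The triple ([h], [b], [c]) describes the trace-free part of [x]; both sides are the discriminant
    of the characteristic polynomial of [x]. *)
Lemma sl2_disc x : h x ^+ 2 + 4 * b x * c x = tr x ^+ 2 - 4.
Proof. by rewrite /h /b /c /tr /sl2_h /sl2_tr; ring: (sl2_det co x). Qed.

(** Scalars commute with everything, so only the trace-free parts matter, and their commutator is
    their cross product. *)
Lemma sl2_commuteP x y : commute x y <->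
  [/\ b x * c y = b y * c x, h x * b y = h y * b x & h x * c y = h y * c x].
Proof.
have Mxy := sl2_M x y; have Myx := sl2_M y x; rewrite /h /sl2_h -/a -/d; split.
  move=> E; rewrite /commute in E.
  have ea_ : a (x * y)%g = a (y * x)%g by rewrite E.
  have eb_ : b (x * y)%g = b (y * x)%g by rewrite E.
  have ec_ : c (x * y)%g = c (y * x)%g by rewrite E.
  move: ea_ eb_ ec_; rewrite !Mxy !Myx => ea_ eb_ ec_.
  by split; [apply: (lin_comb ea_) | apply: (lin_comb eb_)
    | apply: (lin_comb (-1 *! ec_))]; ring.
by case=> e1 e2 e3; apply: (@sl2_inj _ _ co); rewrite -/a -/b -/c -/d !Mxy !Myx;
  [apply: (lin_comb e1) | apply: (lin_comb e2) | apply: (lin_comb (-1 *! e3))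
  | apply: (lin_comb (-1 *! e1))]; ring.
Qed.

(** A nonzero discriminant means distinct eigenvalues, so that the centralizer is a torus. Good
    elements also have nonzero trace, as [larsen_pink] requires. *)
Definition sl2_regular x := tr x ^+ 2 != 4.
Definition sl2_good x := sl2_regular x && (tr x != 0).

Lemma sl2_regularJ x y : sl2_regular (x ^ y)%g = sl2_regular x.
Proof. by rewrite /sl2_regular sl2_trJ. Qed.

Lemma cent1_line z x : sl2_regular z -> x \in 'C[z]%g ->
  exists k, [/\ h x = k * h z, b x = k * b z & c x = k * c z].
Proof.
move=> rz /cent1P /sl2_commuteP[e1 e2 e3].
apply: parallel3; rewrite ?[b x * c z]e1 ?e2 ?e3 1?mulrC //.
apply: contra rz => /and3P[/eqP hz /eqP bz _]; rewrite /sl2_regular -subr_eq0.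
by rewrite -sl2_disc hz bz; apply/eqP; ring.
Qed.

(** The trace-free parts of [x] and [y] are multiples of that of [z]. Equal traces give equal
    discriminants, so the two factors agree up to sign, and inversion is what changes the sign. *)
Lemma cent1_same_trace z x y : sl2_regular z -> x \in 'C[z]%g -> y \in 'C[z]%g ->
  tr x = tr y -> y = x \/ y = x^-1%g.
Proof.
move=> rz /(cent1_line rz)[k [hx bx cx]] /(cent1_line rz)[l [hy by_ cy]] exy.
have Dx := sl2_disc x; have Dy := sl2_disc y; have Dz := sl2_disc z.
have kl : (l - k) * (l + k) * (tr z ^+ 2 - 4) = 0.
  rewrite -Dz; move: Dx Dy; rewrite hx bx cx hy by_ cy exy => <- E.
  by apply: (lin_comb E); ring.
move/eqP: kl; rewrite !mulf_eq0 [_ - 4 == 0]subr_eq0 (negPf rz) orbF => /orP[].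
  rewrite subr_eq0 => /eqP lk; left; apply: sl2_vec_inj => //;
  by rewrite ?hx ?bx ?cx ?hy ?by_ ?cy lk.
rewrite addr_eq0 => /eqP lk; right; have V := sl2_V x.
apply: sl2_vec_inj; rewrite ?sl2_trV ?V //.
- by rewrite hy lk mulNr -hx /h /sl2_h -/a -/d !V; ring.
- by rewrite by_ bx lk; ring.
by rewrite cy cx lk; ring.
Qed.
End Coordinates.

(** * Sizes of tori and of the group *)

Section Counting.
Variables (F : finFieldType) (gT : finGroupType) (co : sl2_coords F gT).
Implicit Types (x y z : gT) (s t : F).

Local Notation a := (ea co).
Local Notation b := (eb co).
Local Notation c := (ec co).
Local Notation d := (ed co).
Local Notation tr := (sl2_tr co).
Local Notation h := (sl2_h co).

Lemma cent1_regular_sub z x : sl2_regular co z -> sl2_regular co x ->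
  x \in 'C[z]%g -> 'C[x]%g \subset 'C[z]%g.
Proof.
move=> rz rx /(cent1_line rz)[k [hx bx cx]]; apply/subsetP => y.
move=> /(cent1_line rx)[l [hy by_ cy]]; apply/cent1P/(sl2_commuteP co).
by rewrite hy by_ cy hx bx cx; split; ring.
Qed.

Lemma cent1_regular_eq z x : sl2_regular co z -> sl2_regular co x ->
  x \in 'C[z]%g -> 'C[x]%g = 'C[z]%g.
Proof.
move=> rz rx xz; apply/eqP; rewrite eqEsubset !cent1_regular_sub //.
by apply/cent1P; apply: commute_sym; apply/cent1P.
Qed.

Lemma card_cent1_trace z s : sl2_regular co z ->
  (#|[set x in 'C[z]%g | tr x == s]| <= 2)%N.
Proof.
move=> rz; case: (set_0Vmem [set x in 'C[z]%g | tr x == s]) => [->|[x0]].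
  by rewrite cards0.
rewrite inE => /andP[x0z /eqP tx0].
apply: (@card_leq2 _ _ x0 x0^-1%g) => x; rewrite inE => /andP[xz /eqP tx].
by apply: (cent1_same_trace rz x0z xz); rewrite tx0.
Qed.

(** The bad traces are 0, 2 and -2. Trace 0 occurs at most twice in the torus; for traces 2 and -2
    the discriminant vanishes, which forces the trace-free part to be 0 and leaves one element
    each. *)
Lemma card_cent1_bad z : sl2_regular co z ->
  (#|[set x in 'C[z]%g | ~~ sl2_good co x]| <= 4)%N.
Proof.
move=> rz; have two0 := sl2_two_neq0 co.
have one s : s ^+ 2 = 4 -> (#|[set x in 'C[z]%g | tr x == s]| <= 1)%N.
  move=> s4; apply/card_le1P => x; rewrite inE.
  move=> /andP[/(cent1_line rz)[k [hx bx cx]] /eqP tx].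
  have k0 l y : [/\ h y = l * h z, b y = l * b z & c y = l * c z] -> tr y = s -> l = 0.
    move=> [hy by_ cy] ty.
    have Dy := sl2_disc co y; have Dz := sl2_disc co z.
    have : l ^+ 2 * (tr z ^+ 2 - 4) = 0.
      rewrite -Dz; move: Dy; rewrite ty s4 hy by_ cy => E.
      by apply: (lin_comb E); ring.
    by move/eqP; rewrite mulf_eq0 expf_eq0 subr_eq0 (negPf rz) orbF => /eqP.
  move=> y; rewrite [LHS]inE [RHS]inE; apply/idP/eqP.
    move=> /andP[/(cent1_line rz)[l ly] /eqP ty].
    have l0 := k0 _ _ ly ty; case: ly => hy by_ cy.
    have kk := k0 _ _ (And3 hx bx cx) tx.
    by apply: (@sl2_vec_inj _ _ co); rewrite ?hx ?hy ?bx ?by_ ?cx ?cy ?l0 ?kk ?mul0r // tx.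
  move=> ->; rewrite tx eqxx andbT; apply/cent1P/(sl2_commuteP co).
  by rewrite hx bx cx; split; ring.
apply: (@leq_trans #|[set x in 'C[z]%g | tr x == 0] :|:
  ([set x in 'C[z]%g | tr x == 2] :|: [set x in 'C[z]%g | tr x == -2])|).
  apply/subset_leq_card/subsetP => x; rewrite !inE negb_and !negbK.
  case/andP=> -> /= /orP[/eqP e4|->] //.
  have: (tr x - 2) * (tr x + 2) = 0 by apply: (lin_comb e4); ring.
  by move/eqP; rewrite mulf_eq0 subr_eq0 addr_eq0 => ->; rewrite orbT.
apply: leq_trans (leq_card_setU _ _) _.
have o2 := one 2 _; have om := one (-2) _.
apply: (@leq_trans (2 + (1 + 1))%N) => //.
apply: leq_add; first exact: card_cent1_trace.
apply: leq_trans (leq_card_setU _ _) _.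
by apply: leq_add; apply: one; ring.
Qed.

Lemma card_cent1_leq z : sl2_regular co z -> (#|'C[z]%g| <= 2 * #|F|)%N.
Proof.
move=> rz; rewrite -cardsT; apply: (@card_fibre_leq _ _ _ _ tr) => // x _.
exact: card_cent1_trace.
Qed.

(* The default value 1 is junk, returned when [a0 d0 - b0 c0] is not 1. *)
Definition sl2_mk a0 b0 c0 d0 : gT :=
  odflt 1%g [pick g | [&& a g == a0, b g == b0, c g == c0 & d g == d0]].

Lemma sl2_mkE a0 b0 c0 d0 : a0 * d0 = 1 + b0 * c0 ->
  let g := sl2_mk a0 b0 c0 d0 in [/\ a g = a0, b g = b0, c g = c0 & d g = d0].
Proof.
move=> /(sl2_surj co)[g [ag bg cg dg]] /=; rewrite /sl2_mk; case: pickP => [x|].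
  by case/and4P=> /eqP -> /eqP -> /eqP -> /eqP ->.
by move/(_ g); rewrite ag bg cg dg !eqxx.
Qed.

Definition sl2_U : {set gT} := [set x | (a x == 1) && (c x == 0)].

Lemma sl2_UP x : reflect [/\ a x = 1, c x = 0 & d x = 1] (x \in sl2_U).
Proof.
rewrite inE; apply: (iffP andP) => [[/eqP ax /eqP cx]|[-> -> _]]; last by rewrite !eqxx.
by split=> //; have := sl2_det co x; rewrite ax cx mul1r mulr0 addr0.
Qed.

Lemma sl2_U_group_set : group_set sl2_U.
Proof.
have [[a1 b1] [c1 d1]] := sl2_1 co.
apply/group_setP; split=> [|x y /sl2_UP[ax cx dx] /sl2_UP[ay cy dy]].
  by apply/sl2_UP.
by rewrite inE !(sl2_M co x y) ax cx dx ay cy; apply/andP; split; apply/eqP; ring.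
Qed.
Canonical sl2_U_group := Group sl2_U_group_set.

Lemma card_sl2_U : #|sl2_U| = #|F|.
Proof.
apply/eqP; rewrite eqn_leq; apply/andP; split.
  rewrite -[X in (_ <= X)%N]cardsT; apply: (@card_inj_leq _ _ _ _ b) => // x y.
  move=> /sl2_UP[ax cx dx] /sl2_UP[ay cy dy] e.
  by apply: (@sl2_inj _ _ co) => //; rewrite ?ax ?cx ?dx.
have mk t : let g := sl2_mk 1 t 0 1 in [/\ a g = 1, b g = t, c g = 0 & d g = 1].
  by apply: sl2_mkE; ring.
rewrite -cardsT; apply: (@card_inj_leq _ _ _ _ (fun t => sl2_mk 1 t 0 1)).
  by move=> t _; rewrite inE; case: (mk t) => -> _ -> _; rewrite !eqxx.
by move=> s t _ _ /(congr1 b); case: (mk s) => _ -> _ _; case: (mk t) => _ ->.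
Qed.

(** Matrices with the same first column lie in one left coset of [sl2_U]. *)
Lemma card_sl2_leq : (#|gT| <= #|F| ^ 3)%N.
Proof.
rewrite expnS -mulnn -cardsT -{1}card_sl2_U -card_prod -[X in (_ * X)%N]cardsT.
apply: (@card_fibre_leq _ _ _ _ (fun x => (a x, c x))) => // x0 _.
apply: (@card_inj_leq _ _ _ _ (fun x => x0^-1 * x)%g) => [x|x y _ _ /mulgI //].
rewrite !inE /= => /eqP[ax cx]; rewrite !(sl2_M co _ x) !(sl2_V co x0).
have D := sl2_det co x0; rewrite ax cx in D *.
by apply/andP; split; apply/eqP; [apply: (lin_comb D) | ]; ring.
Qed.

Lemma card_sl2_geq : ((#|F| - 1) * #|F| ^ 2 <= #|gT|)%N.
Proof.
have mk (u : F * (F * F)) : u.1 != 0 ->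
  let g := sl2_mk u.1 u.2.1 u.2.2 (u.1^-1 * (1 + u.2.1 * u.2.2)) in
  [/\ a g = u.1, b g = u.2.1, c g = u.2.2 & d g = u.1^-1 * (1 + u.2.1 * u.2.2)].
  by move=> u0; apply: sl2_mkE; rewrite mulrA mulfV // mul1r.
have -> : ((#|F| - 1) * #|F| ^ 2)%N = #|setX [set x : F | x != 0] [set: F * F]|.
  by rewrite cardsX cardsT card_prod mulnn subn1 -(cardC1 (0 : F)) cardsE.
rewrite -[X in (_ <= X)%N]cardsT.
apply: (@card_inj_leq _ _ _ _ (fun u : F * (F * F) =>
  sl2_mk u.1 u.2.1 u.2.2 (u.1^-1 * (1 + u.2.1 * u.2.2)))).
  by move=> u; rewrite inE.
case=> [u1 [u2 u3]] [v1 [v2 v3]]; rewrite !inE /= !andbT => u0 v0 E.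
case: (mk (u1, (u2, u3)) u0) => /=; rewrite E.
by case: (mk (v1, (v2, v3)) v0) => /= -> -> -> _ -> -> ->.
Qed.
End Counting.

(** * Fixed lines *)

Section Lines.
Variables (F : finFieldType) (gT : finGroupType) (co : sl2_coords F gT).
Implicit Types (x y z g : gT) (s t l : F) (e f : F * F) (B : {set gT}).

Local Notation a := (ea co).
Local Notation b := (eb co).
Local Notation c := (ec co).
Local Notation d := (ed co).
Local Notation tr := (sl2_tr co).
Local Notation h := (sl2_h co).

Definition sl2_act x e : F * F := (a x * e.1 + b x * e.2, c x * e.1 + d x * e.2).
Definition wedge e f : F := e.1 * f.2 - e.2 * f.1.
Definition scale_pair l e : F * F := (l * e.1, l * e.2).
(** For [e] nonzero: the line spanned by [e] is invariant under [x]. *)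
Definition sl2_fix x e := wedge e (sl2_act x e) == 0.

Lemma sl2_actM x y e : sl2_act (x * y)%g e = sl2_act x (sl2_act y e).
Proof. by rewrite /sl2_act !sl2_M /=; congr pair; ring. Qed.

Lemma sl2_actZ x l e : sl2_act x (scale_pair l e) = scale_pair l (sl2_act x e).
Proof. by rewrite /sl2_act /scale_pair /=; congr pair; ring. Qed.

Lemma sl2_act1 e : sl2_act 1%g e = e.
Proof. by case: e => u v; rewrite /sl2_act !sl2_1 /=; congr pair; ring. Qed.

Lemma sl2_fixE x e :
  sl2_fix x e = (c x * e.1 ^+ 2 - h x * e.1 * e.2 - b x * e.2 ^+ 2 == 0).
Proof. by congr (_ == 0); rewrite /wedge /sl2_act /sl2_h /=; ring. Qed.

Lemma pair_neq0P e : reflect (e.1 != 0 \/ e.2 != 0) (e != 0).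
Proof.
apply: (iffP idP) => [|[]]; try by apply: contraNneq => ->.
case: e => u v; have [->|] := eqVneq u 0; last by left.
have [->|] := eqVneq v 0; last by right.
by case/eqP.
Qed.

Lemma sl2_fix_wedge x e f : e != 0 -> sl2_fix x e -> wedge e f = 0 -> sl2_fix x f.
Proof.
move=> /pair_neq0P e0; rewrite !sl2_fixE => /eqP fe /eqP; rewrite subr_eq0 => /eqP w0.
case: e0 => [e1|e2].
  apply/eqP/(mulIf (expf_neq0 2 e1)); rewrite mul0r.
  have w2 : (e.1 * f.2) ^+ 2 = (e.2 * f.1) ^+ 2 by rewrite w0.
  apply: (lin_comb (f.1 ^+ 2 *! fe +! (- h x * f.1 * e.1) *! w0 (-) b x *! w2)).
  by ring.
apply/eqP/(mulIf (expf_neq0 2 e2)); rewrite mul0r.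
have w2 : (e.1 * f.2) ^+ 2 = (e.2 * f.1) ^+ 2 by rewrite w0.
apply: (lin_comb (f.2 ^+ 2 *! fe +! (h x * f.2 * e.2) *! w0 (-) c x *! w2)).
by ring.
Qed.

Lemma sl2_fix_eigen x e : e != 0 -> sl2_fix x e ->
  exists l, sl2_act x e = scale_pair l e.
Proof.
move=> /pair_neq0P e0; rewrite /sl2_fix /wedge => /eqP; case: (sl2_act x e) => u v /=.
case: e0 => [e1|e2] /eqP; rewrite subr_eq0 => /eqP E.
  exists (u / e.1); rewrite /scale_pair divfK //; congr pair.
  by apply: (mulfI e1); rewrite E mulrA mulrCA mulfV // mulr1 mulrC.
exists (v / e.2); rewrite /scale_pair divfK //; congr pair.
by apply: (mulfI e2); rewrite -E mulrA mulrCA mulfV // mulr1 mulrC.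
Qed.

(** The eigenvalue [l] is a root of the characteristic polynomial, whose roots have sum [tr x] and
    product 1. *)
Lemma sl2_eigen_tr x e l : e != 0 -> sl2_act x e = scale_pair l e ->
  l * (tr x - l) = 1.
Proof.
move=> /pair_neq0P e0 [E1 E2]; have D := sl2_det co x.
case: e0 => [e1|e2].
  apply: (mulfI e1); rewrite /sl2_tr.
  apply: (lin_comb ((l - d x) *! E1 +! b x *! E2 +! e.1 *! D)); ring.
apply: (mulfI e2); rewrite /sl2_tr.
apply: (lin_comb ((l - a x) *! E2 +! c x *! E1 +! e.2 *! D)); ring.
Qed.

Lemma sl2_act_fix2 x e f :
  wedge e f != 0 -> sl2_act x e = e -> sl2_act x f = f -> x = 1%g.
Proof.
move=> w0; case: e f w0 => e1 e2 [f1 f2]; rewrite /wedge /sl2_act /= => w0.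
move=> [Ea Ec] [Fa Fc].
by apply: (@sl2_inj _ _ co); rewrite !sl2_1; apply: (mulfI w0);
  [ apply: (lin_comb (f2 *! Ea (-) e2 *! Fa)) | apply: (lin_comb (e1 *! Fa (-) f1 *! Ea))
  | apply: (lin_comb (f2 *! Ec (-) e2 *! Fc)) | apply: (lin_comb (e1 *! Fc (-) f1 *! Ec))];
  ring.
Qed.

Lemma sl2_fixM x y e : e != 0 -> sl2_fix x e -> sl2_fix y e -> sl2_fix (x * y)%g e.
Proof.
move=> e0 /(sl2_fix_eigen e0)[l xl] /(sl2_fix_eigen e0)[m ym].
by rewrite /sl2_fix sl2_actM ym sl2_actZ xl /wedge /scale_pair /=; apply/eqP; ring.
Qed.

Lemma sl2_not_fix e : e != 0 -> exists x, ~~ sl2_fix x e.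
Proof.
move=> /pair_neq0P[e1|e2].
  have [|x [ax bx cx dx]] := @sl2_surj _ _ co 1 0 1 1; first by ring.
  exists x; rewrite sl2_fixE /sl2_h ax bx cx dx (_ : _ - _ = e.1 ^+ 2); last by ring.
  exact: expf_neq0.
have [|x [ax bx cx dx]] := @sl2_surj _ _ co 1 1 0 1; first by ring.
exists x; rewrite sl2_fixE /sl2_h ax bx cx dx (_ : _ - _ = - e.2 ^+ 2); last by ring.
by rewrite oppr_eq0 expf_neq0.
Qed.

Lemma gen_not_fix B e : <<B>>%g = [set: gT] -> e != 0 ->
  exists2 g, g \in B & ~~ sl2_fix g e.
Proof.
move=> genB e0; have [x xe] := sl2_not_fix e0.
have [||y [g [ye gB yge]]] := @gen_escape _ B [set x | sl2_fix x e] x genB.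
- by rewrite inE /sl2_fix sl2_act1 /wedge mulrC subrr.
- by rewrite inE.
exists g => //; apply: contra yge => ge; rewrite !inE in ye *; exact: sl2_fixM.
Qed.

(** * Elements of a set which fix a given line *)

Section Borel.
Variable B : {set gT}.
Hypotheses (genB : <<B>>%g = [set: gT]) (BV : (B^-1)%g = B).

(** Let [g] in [B] move the line of [e]. Pairs are sent to [x (g y g^-1)]. If two pairs have the
    same image, then [x'^-1 x] fixes both [e] and [g e], which are independent, so it is 1 and the
    map is injective. *)
Lemma card_eigen e l : e != 0 ->
  (#|[set x in B | sl2_act x e == scale_pair l e]| ^ 2 <= #|(B ^+ 4)%g|)%N.
Proof.
move=> e0; have [g gB ge] := gen_not_fix genB e0.
set X := finset _; rewrite -mulnn -cardsX.
have [->|[x1 x1X]] := set_0Vmem X; first by rewrite cardsX cards0.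
have l0 : l != 0.
  move: x1X; rewrite inE => /andP[_ /eqP /(sl2_eigen_tr e0)]; apply: contra_eq_neq => ->.
  by rewrite mul0r eq_sym oner_neq0.
have XV x y : x \in X -> y \in X ->
    sl2_act (x * y^-1)%g e = e /\ sl2_act (y^-1 * x)%g e = e.
  rewrite !inE => /andP[_ /eqP xe] /andP[_ /eqP ye].
  have yVe : sl2_act y^-1%g e = scale_pair l^-1 e.
    have E : sl2_act y^-1%g (sl2_act y e) = e by rewrite -sl2_actM mulVg sl2_act1.
    rewrite -[in RHS]E ye sl2_actZ; case: (sl2_act _ e) => u v.
    by rewrite /scale_pair /= !mulrA mulVf // !mul1r.
  split; rewrite sl2_actM ?yVe ?xe sl2_actZ ?xe ?yVe; case: (e) => u v;
  by rewrite /scale_pair /= !mulrA ?mulVf ?mulfV // !mul1r.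
apply: (@card_inj_leq _ _ _ _ (fun u => u.1 * (g * u.2 * g^-1))%g).
  case=> x y /setXP[/= xX yX].
  have [xB yB] : x \in B /\ y \in B by rewrite !inE in xX yX; case/andP: xX; case/andP: yX.
  apply: (@mem_expg_mul _ B 1 3); first by rewrite expg1.
  apply: (@mem_expg_mul _ B 2 1); last by rewrite expg1 -BV memV_invg.
  by apply: (@mem_expg_mul _ B 1 1); rewrite expg1.
case=> x y [x' y'] /setXP[/= xX yX] /setXP[/= x'X y'X] E.
have En : (x'^-1 * x = g * (y' * y^-1) * g^-1)%g.
  apply: (mulIg (g * y * g^-1)%g); apply: (mulgI x'); rewrite !mulgA mulgV mul1g.
  by rewrite !mulgA in E; rewrite E !mulgKV.
have n1 : (x'^-1 * x = 1)%g.
  apply: sl2_act_fix2 ge _ _; first by case: (XV x x' xX x'X).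
  rewrite En -sl2_actM mulgKV sl2_actM; congr sl2_act.
  by case: (XV y' y y'X yX).
have exx : x = x' by apply: (mulgI x'^-1%g); rewrite n1 mulVg.
congr pair => //; move: E; rewrite exx => /mulgI /mulIg /mulgI //.
Qed.

(** On [e] such an element has one of only two eigenvalues, [l] and [s - l], and [card_eigen] bounds
    each class. *)
Lemma card_fix e s : e != 0 ->
  (#|[set x in B | (tr x == s) && sl2_fix x e]| ^ 2 <= 4 * #|(B ^+ 4)%g|)%N.
Proof.
move=> e0; set X := finset _.
have [->|[x1 x1X]] := set_0Vmem X; first by rewrite cards0.
have eig x : x \in X -> exists2 l, sl2_act x e = scale_pair l e & l * (s - l) = 1.
  rewrite inE => /and3P[_ /eqP <- /(sl2_fix_eigen e0)[l E]].
  by exists l => //; apply: sl2_eigen_tr E.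
have [l _ El] := eig _ x1X.
pose Y l := [set x in B | sl2_act x e == scale_pair l e].
have sub : X \subset Y l :|: Y (s - l).
  apply/subsetP => x xX; have [m Em Hm] := eig _ xX; move: xX.
  rewrite !inE Em => /and3P[-> _ _] /=.
  have : (m - l) * (m - (s - l)) = 0 by apply: (lin_comb (El (-) Hm)); ring.
  by move/eqP; rewrite mulf_eq0 !subr_eq0 => /orP[] /eqP ->; rewrite eqxx ?orbT.
have XY : (#|X| <= #|Y l| + #|Y (s - l)%R|)%N.
  by apply: leq_trans (subset_leq_card sub) (leq_card_setU _ _).
have Yl m : (#|Y m| ^ 2 <= #|(B ^+ 4)%g|)%N by apply: card_eigen.
have Y1 := Yl l; have Y2 := Yl (s - l).
rewrite -leq_sqr sqrnD in XY; have [CS _] := nat_Cauchy #|Y l| #|Y (s - l)|.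
by rewrite -!mulnn in XY CS Y1 Y2 *; lia.
Qed.

(* A binary quadratic form with three pairwise non-proportional zeros vanishes. *)
Lemma sl2_fix3 x e1 e2 e3 : sl2_fix x e1 -> sl2_fix x e2 -> sl2_fix x e3 ->
    wedge e1 e2 != 0 -> wedge e1 e3 != 0 -> wedge e2 e3 != 0 ->
  ~~ sl2_regular co x.
Proof.
rewrite !sl2_fixE; case: e1 e2 e3 => u1 v1 [u2 v2] [u3 v3]; rewrite /wedge /=.
move=> /eqP q1 /eqP q2 /eqP q3 w12 w13 w23; rewrite /sl2_regular negbK -subr_eq0.
have w0 := mulf_neq0 (mulf_neq0 w12 w13) w23.
rewrite -sl2_disc.
have -> : c x = 0.
  apply: (mulfI w0); apply: (lin_comb ((v2 * v3 * (u2 * v3 - v2 * u3)) *! q1 (-)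
    (v1 * v3 * (u1 * v3 - v1 * u3)) *! q2 +! (v1 * v2 * (u1 * v2 - v1 * u2)) *! q3)).
  ring.
have -> : h x = 0.
  apply: (mulfI w0); apply: (lin_comb (((u2 * v3 + u3 * v2) * (u2 * v3 - v2 * u3)) *! q1 (-)
    ((u1 * v3 + u3 * v1) * (u1 * v3 - v1 * u3)) *! q2 +!
    ((u1 * v2 + u2 * v1) * (u1 * v2 - v1 * u2)) *! q3)).
  ring.
by apply/eqP; ring.
Qed.

Definition share_line x y := [exists e : F * F, [&& e != 0, sl2_fix x e & sl2_fix y e]].

Lemma card_share_line x s r : sl2_regular co x ->
    (forall e, e != 0 -> (#|[set y in B | (tr y == s) && sl2_fix y e]| <= r)%N) ->
  (#|[set y in B | (tr y == s) && share_line x y]| <= 2 * r)%N.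
Proof.
move=> rx Hr; pose X e := [set y in B | (tr y == s) && sl2_fix y e].
suff [e1 [e2 [e10 e20 sub]]] : exists e1 e2 : F * F, [/\ e1 != 0, e2 != 0 &
    [set y in B | (tr y == s) && share_line x y] \subset X e1 :|: X e2].
  apply: leq_trans (subset_leq_card sub) _.
  by apply: leq_trans (leq_card_setU _ _) _; rewrite mul2n -addnn leq_add ?Hr.
have [/existsP[e1 /andP[e10 xe1]]|N1] :=
    boolP [exists e : F * F, (e != 0) && sl2_fix x e]; last first.
  (* If [x] fixes no line the set is empty, and any nonzero vectors will do. *)
  exists ((1, 0) : F * F), ((1, 0) : F * F); split;
    try by apply/pair_neq0P; left; rewrite oner_neq0.
  apply/subsetP => y; rewrite inE => /and3P[_ _ /existsP[e /and3P[e0 xe _]]].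
  by case/negP: N1; apply/existsP; exists e; rewrite e0.
have [e2 [e20 xe2 He2]] : exists e2, [/\ e2 != 0, sl2_fix x e2 &
    forall e, e != 0 -> sl2_fix x e -> wedge e e1 = 0 \/ wedge e e2 = 0].
  have [/existsP[e2 /and3P[e20 xe2 w12]]|N2] :=
      boolP [exists e2 : F * F, [&& e2 != 0, sl2_fix x e2 & wedge e1 e2 != 0]].
    exists e2; split=> // e e0 xe.
    have [w|w] := eqVneq (wedge e e1) 0; first by left.
    have [w'|w'] := eqVneq (wedge e e2) 0; first by right.
    by have := sl2_fix3 xe xe1 xe2 w w' w12; rewrite rx.
  (* When [x] fixes only the line of [e1], that line is listed twice. *)
  exists e1; split=> // e e0 xe; left; apply/eqP; apply: contraNT N2 => w.
  apply/existsP; exists e; rewrite e0 xe /=.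
  by apply: contraNneq w; rewrite /wedge => w; apply/eqP; apply: (lin_comb (-1 *! w)); ring.
exists e1, e2; split=> //; apply/subsetP => y.
rewrite !inE => /and3P[-> -> /existsP[e /and3P[e0 xe ye]]] /=.
by case: (He2 e e0 xe) => w; rewrite (sl2_fix_wedge e0 ye w) ?orbT.
Qed.
End Borel.
End Lines.

(** * Elements of a given trace *)

Section LarsenPink.
Variables (F : finFieldType) (gT : finGroupType) (co : sl2_coords F gT).
Implicit Types (x y z g : gT) (s t l : F) (e f : F * F) (B : {set gT}).

Local Notation a := (ea co).
Local Notation b := (eb co).
Local Notation c := (ec co).
Local Notation d := (ed co).
Local Notation tr := (sl2_tr co).
Local Notation h := (sl2_h co).

Lemma sl2_trM x y : 2 * tr (x * y)%g =
  tr x * tr y + h x * h y + 2 * (b x * c y + c x * b y).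
Proof. by rewrite /sl2_tr /sl2_h !sl2_M; ring. Qed.

(* A nonzero trace-zero matrix [w] with [det w = 0] is, up to scaling, [v |-> (e ^ v) e];
   being orthogonal to it amounts to fixing the line of [e]. *)
Lemma isotropic_share_line wh wb wc x y :
    ~~ [&& wh == 0, wb == 0 & wc == 0] -> wh ^+ 2 + 4 * wb * wc = 0 ->
    wh * h x + 2 * (wb * c x + wc * b x) = 0 ->
    wh * h y + 2 * (wb * c y + wc * b y) = 0 ->
  share_line co x y.
Proof.
move=> w0 iso px py; have two0 := sl2_two_neq0 co.
have [wb0|wb0] := eqVneq wb 0.
  have wh0 : wh = 0 by apply/eqP; rewrite -sqrf_eq0 -iso wb0; apply/eqP; ring.
  move: w0 px py; rewrite wb0 wh0 !eqxx /= => wc0 px py.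
  have z2 : 2 * wc != 0 by rewrite mulf_neq0.
  apply/existsP; exists (0, 1); apply/and3P; split.
  - by apply/pair_neq0P; right; rewrite oner_neq0.
  - by rewrite sl2_fixE /=; apply/eqP/(mulfI z2); apply: (lin_comb (-1 *! px)); ring.
  by rewrite sl2_fixE /=; apply/eqP/(mulfI z2); apply: (lin_comb (-1 *! py)); ring.
apply/existsP; exists (2 * wb, - wh); apply/and3P; split.
- by apply/pair_neq0P; left; rewrite mulf_neq0.
- rewrite sl2_fixE /=; apply/eqP.
  by apply: (lin_comb ((2 * wb) *! px (-) (b x) *! iso)); ring.
rewrite sl2_fixE /=; apply/eqP.
by apply: (lin_comb ((2 * wb) *! py (-) (b y) *! iso)); ring.
Qed.

(** * Left translates of a triple of matrices of equal trace *)

Section Triple.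
Variables (x1 x2 x3 : gT) (s : F).
Hypotheses (s0 : s != 0) (t1 : tr x1 = s) (t2 : tr x2 = s) (t3 : tr x3 = s).
Hypotheses (n12 : x2 != x1) (n13 : x3 != x1) (n23 : x3 != x2).
Hypothesis nsh : ~~ share_line co x1 x2.

Let uh := h x2 - h x1. Let ub := b x2 - b x1. Let uc := c x2 - c x1.
Let vh := h x3 - h x1. Let vb := b x3 - b x1. Let vc := c x3 - c x1.
(* The cross product of [x2 - x1] and [x3 - x1] for the trace form. *)
Let wh := 2 * (uc * vb - ub * vc).
Let wb := ub * vh - uh * vb.
Let wc := uh * vc - uc * vh.

Let disc_eq x : tr x = s -> h x ^+ 2 + 4 * b x * c x = s ^+ 2 - 4.
Proof. by move=> tx; rewrite sl2_disc tx. Qed.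

Let u_neq0 : ~~ [&& uh == 0, ub == 0 & uc == 0].
Proof.
apply: contra n12; rewrite !subr_eq0 => /and3P[/eqP e1 /eqP e2 /eqP e3].
by apply/eqP/(sl2_vec_inj (co := co)); rewrite ?t1 ?t2.
Qed.

(** If [w] were 0, the three points would lie on one affine line of direction [u] inside the quadric
    of trace [s]. A non-isotropic direction leaves at most two points on it, so two of them would
    coincide. For an isotropic [u], both [x1] and [x2] are orthogonal to [u], hence share a fixed
    line. *)
Let w_neq0 : ~~ [&& wh == 0, wb == 0 & wc == 0].
Proof.
have two0 := sl2_two_neq0 co.
apply/negP; rewrite /wh mulf_eq0 (negPf two0) /= => /and3P[/eqP e1 /eqP e2 /eqP e3].
have [k [kh kb kc]] : exists k, [/\ vh = k * uh, vb = k * ub & vc = k * uc].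
  apply: parallel3 u_neq0 _ _ _.
  - by apply: (lin_comb e2); rewrite /wb; ring.
  - by apply: (lin_comb (-1 *! e3)); rewrite /wc; ring.
  by apply: (lin_comb e1); ring.
have D1 := disc_eq t1; have D2 := disc_eq t2; have D3 := disc_eq t3.
have Ek : k * (k - 1) * (uh ^+ 2 + 4 * ub * uc) = 0.
  have h3 : h x3 = h x1 + k * uh by rewrite -kh /vh; ring.
  have b3 : b x3 = b x1 + k * ub by rewrite -kb /vb; ring.
  have c3 : c x3 = c x1 + k * uc by rewrite -kc /vc; ring.
  rewrite h3 b3 c3 in D3.
  by apply: (lin_comb ((D3 (-) D1) (-) k *! (D2 (-) D1))); rewrite /uh /ub /uc; ring.
move/eqP: Ek; rewrite !mulf_eq0 -orbA => /or3P[/eqP k0|k1|/eqP U0].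
- case/negP: n13; apply/eqP/(sl2_vec_inj (co := co)); rewrite ?t1 ?t3 //;
  by apply/eqP; rewrite -subr_eq0; apply/eqP; 
    rewrite -?/vh -?/vb -?/vc ?kh ?kb ?kc k0 mul0r.
- have {}k1 : k = 1 by apply/eqP; rewrite -subr_eq0.
  case/negP: n23; apply/eqP/(sl2_vec_inj (co := co)); rewrite ?t2 ?t3 //;
  apply/eqP; rewrite -subr_eq0; apply/eqP.
  + by apply: (lin_comb kh); rewrite k1 /uh /vh; ring.
  + by apply: (lin_comb kb); rewrite k1 /ub /vb; ring.
  by apply: (lin_comb kc); rewrite k1 /uc /vc; ring.
have P1 : uh * h x1 + 2 * (ub * c x1 + uc * b x1) = 0.
  apply: (mulfI two0); apply: (lin_comb ((D2 (-) D1) (-) U0)).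
  by rewrite /uh /ub /uc; ring.
case/negP: nsh; apply: (isotropic_share_line u_neq0 U0 P1).
by apply: (lin_comb (P1 +! U0)); rewrite /uh /ub /uc; ring.
Qed.

Let perp g := [/\ tr (g * x1)%g = s, tr (g * x2)%g = s & tr (g * x3)%g = s].

(** For the trace form, [g] is orthogonal to [x2 - x1] and [x3 - x1], so its trace-free part is a
    multiple of their cross product. *)
Let perp_line g : perp g -> exists n, [/\ h g = n * wh, b g = n * wb & c g = n * wc].
Proof.
case=> p1 p2 p3; have two0 := sl2_two_neq0 co.
have T1 := sl2_trM g x1; have T2 := sl2_trM g x2; have T3 := sl2_trM g x3.
rewrite p1 p2 p3 t1 t2 t3 in T1 T2 T3.
have U : uh * h g + 2 * (uc * b g + ub * c g) = 0.
  by apply: (lin_comb (T1 (-) T2)); rewrite /uh /ub /uc; ring.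
have V : vh * h g + 2 * (vc * b g + vb * c g) = 0.
  by apply: (lin_comb (T1 (-) T3)); rewrite /vh /vb /vc; ring.
have C1 : h g * wb = b g * wh.
  by apply: (lin_comb (ub *! V (-) vb *! U)); rewrite /wh /wb; ring.
have C2 : h g * wc = c g * wh.
  by apply: (lin_comb (vc *! U (-) uc *! V)); rewrite /wh /wc; ring.
have C3 : b g * wc = c g * wb.
  apply: (mulfI two0).
  by apply: (lin_comb (uh *! V (-) vh *! U)); rewrite /wb /wc; ring.
exact: parallel3 w_neq0 _ _ _.
Qed.

(** The trace-free part of [g] is [n w]. The trace of [g x1] gives an equation linear in [n], and
    the discriminant one in [n ^+ 2]. If [p] is 0, then [w] is isotropic and [x1], [x2] share a
    line. Otherwise eliminating [n] leaves an equation linear in [tr g], which determines [tr g] and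
    then [n]. *)
Lemma translate_unique g g' :
    [/\ tr (g * x1)%g = s, tr (g * x2)%g = s & tr (g * x3)%g = s] -> g != 1%g ->
    [/\ tr (g' * x1)%g = s, tr (g' * x2)%g = s & tr (g' * x3)%g = s] -> g' != 1%g ->
  g = g'.
Proof.
have two0 := sl2_two_neq0 co.
pose p := wh * h x1 + 2 * (wb * c x1 + wc * b x1).
pose q := wh ^+ 2 + 4 * wb * wc.
have eqs y : perp y -> y != 1%g ->
    exists n, [/\ h y = n * wh, b y = n * wb & c y = n * wc] /\
    [/\ n * p = (2 - tr y) * s, n ^+ 2 * q = (tr y - 2) * (tr y + 2) & tr y = 2 -> n != 0].
  move=> py y1; have [n [hy by_ cy]] := perp_line py; exists n; split=> //.
  case: py => p1 _ _; have T1 := sl2_trM y x1; rewrite p1 t1 hy by_ cy in T1.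
  have Dy := sl2_disc co y; rewrite hy by_ cy in Dy; split.
  - by apply: (lin_comb (-1 *! T1)); rewrite /p; ring.
  - by apply: (lin_comb Dy); rewrite /q; ring.
  move=> ty; apply: contraNneq y1 => n0; apply/eqP/(sl2_vec_inj (co := co)).
  - by rewrite ty /sl2_tr !sl2_1; ring.
  - by rewrite hy n0 /sl2_h !sl2_1; ring.
  - by rewrite by_ n0 sl2_1; ring.
  by rewrite cy n0 sl2_1; ring.
move=> /eqs Hg g1 /eqs Hg' g'1; have [n [[hg bg cg] [np nq nz]]] := Hg g1.
have [m [[hg' bg' cg'] [mp mq mz]]] := Hg' g'1.
have [p0|p0] := eqVneq p 0.
  have tg : tr g = 2.
    move/eqP: np; rewrite p0 mulr0 eq_sym mulf_eq0 (negPf s0) orbF subr_eq0.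
    by move/eqP.
  have q0 : q = 0.
    move/eqP: nq; rewrite tg subrr mul0r mulf_eq0 expf_eq0 (negPf (nz tg)).
    by move/eqP.
  case/negP: nsh; apply: (isotropic_share_line w_neq0 q0 p0).
  by apply: (lin_comb p0); rewrite /p /wh /wb /wc /uh /ub /uc /vh /vb /vc; ring.
(* The trace 2 is excluded: it would make [k * p] zero with both factors nonzero. *)
have ne2 y k : k * p = (2 - tr y) * s -> (tr y = 2 -> k != 0) -> tr y - 2 != 0.
  move=> kp kz; rewrite subr_eq0; apply/eqP => ty; move: kp => /eqP.
  by rewrite ty subrr mul0r mulf_eq0 (negPf p0) orbF (negPf (kz ty)).
have key y k : k * p = (2 - tr y) * s -> tr y - 2 != 0 ->
    k ^+ 2 * q = (tr y - 2) * (tr y + 2) -> (tr y - 2) * (s ^+ 2 * q) = (tr y + 2) * p ^+ 2.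
  move=> kp y2 kq; apply: (mulfI y2).
  have kp2 : (k * p) ^+ 2 = ((2 - tr y) * s) ^+ 2 by rewrite kp.
  by apply: (lin_comb (p ^+ 2 *! kq (-) q *! kp2)); ring.
have Kg := key _ _ np (ne2 _ _ np nz) nq; have Kg' := key _ _ mp (ne2 _ _ mp mz) mq.
have E4 : (tr g - tr g') * (4 * p ^+ 2) = 0.
  by apply: (lin_comb ((tr g' - 2) *! Kg (-) (tr g - 2) *! Kg')); ring.
have four0 : (4 : F) != 0.
  by rewrite (_ : 4 = 2 * 2 :> F); [rewrite mulf_neq0 | ring].
have tgg : tr g = tr g'.
  move/eqP: E4; rewrite mulf_eq0 (negPf (mulf_neq0 four0 (expf_neq0 2 p0))) orbF.
  by rewrite subr_eq0 => /eqP.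
have nm : n = m by apply: (mulIf p0); rewrite np mp tgg.
by apply: (sl2_vec_inj (co := co)); rewrite ?tgg ?hg ?hg' ?bg ?bg' ?cg ?cg' ?nm.
Qed.
End Triple.
End LarsenPink.

(** * The Larsen-Pink bound *)

Section TraceFibre.
Variables (F : finFieldType) (gT : finGroupType) (co : sl2_coords F gT).
Implicit Types (x y z g : gT) (s : F) (e : F * F).
Local Notation tr := (sl2_tr co).
Variable B : {set gT}.
Hypotheses (genB : <<B>>%g = [set: gT]) (B1 : 1%g \in B) (BV : (B^-1)%g = B).

Lemma larsen_pink s : s != 0 -> s ^+ 2 != 4 ->
  (#|[set x in B | tr x == s]| ^ 3 <= 2 ^ 16 * #|(B ^+ 4)%g| ^ 2)%N.
Proof.
move=> s0 s4; set X := [set x in B | tr x == s]; set K := #|(B ^+ 4)%g|.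
have XP x : x \in X -> x \in B /\ tr x = s by rewrite inE => /andP[-> /eqP].
have K0 : (0 < K)%N by apply/card_gt0P; exists 1%g; apply: expg_one_mem.
pose Xe e := [set x in B | (tr x == s) && sl2_fix co x e].
(* If an eighth of [X] fixes one line, [card_fix] gives [|X|^2 <= 64 * 4 K], whose square is the
   source of the constant 2 ^ 16. Otherwise at most a quarter of the triples start with two entries
   sharing a line. *)
have [/existsP[e /andP[e0 Le]]|Ne] :=
    boolP [exists e : F * F, (e != 0) && (#|X| <= 8 * #|Xe e|)%N].
  have H4 := card_fix co genB BV s e0; rewrite -/(Xe e) -/K in H4.
  have H2 : (#|X| * #|X| <= 256 * K)%N by rewrite -mulnn in H4; nia.
  have H1 : (#|X| <= #|X| * #|X|)%N by case: #|X| => // m; rewrite mulnS leq_addr.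
  have := leq_mul H2 H2; have := leq_mul H1 (leqnn (#|X| * #|X|)).
  by rewrite -mulnn !expnS expn0 !muln1; lia.
have Hr e : e != 0 -> (#|Xe e| <= #|X| %/ 8)%N.
  move=> e0; rewrite leq_divRL // mulnC.
  by move: Ne; rewrite negb_exists => /forallP/(_ e); rewrite e0 /= -ltnNge; lia.
pose X3 := setX X (setX X X).
pose bad1 := [set u in X3 | share_line co u.1 u.2.1].
pose bad2 := [set u in X3 | u.2.1 == u.1].
pose bad3 := [set u in X3 | u.2.2 == u.1].
pose bad4 := [set u in X3 | u.2.2 == u.2.1].
pose good := X3 :\: (bad1 :|: (bad2 :|: (bad3 :|: bad4))).
have X3P u : u \in X3 -> [/\ u.1 \in X, u.2.1 \in X & u.2.2 \in X].
  by case: u => x [y z] /setXP[? /setXP[]].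
have cb1 : (#|bad1| <= 2 * (#|X| %/ 8) * #|setX X X|)%N.
  apply: (@card_fibre_leq _ _ _ _ (fun u => (u.1, u.2.2))).
    by move=> u; rewrite inE => /andP[/X3P[u1 _ u3] _]; rewrite in_setX u1.
  move=> u0; rewrite inE => /andP[/X3P[u1 _ u3] _].
  have rx : sl2_regular co u0.1 by rewrite /sl2_regular (XP _ u1).2.
  apply: leq_trans (card_share_line (B := B) rx Hr).
  apply: (@card_inj_leq _ _ _ _ (fun u => u.2.1)).
    move=> u /setIdP[/setIdP[/X3P[_ /XP[uB ut] _] sh] /eqP[e1 e3]].
    by rewrite inE uB ut eqxx -e1.
  move=> [x [y z]] [x' [y' z']] /setIdP[_ /eqP[/= -> ->]].
  by move=> /setIdP[_ /eqP[/= -> ->]] ->.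
have cb2 : (#|bad2| <= #|setX X X|)%N.
  apply: (@card_inj_leq _ _ _ _ (fun u => (u.1, u.2.2))).
    by move=> u; rewrite inE => /andP[/X3P[u1 _ u3] _]; rewrite in_setX u1.
  move=> [x [y z]] [x' [y' z']] /setIdP[_ /eqP /= ->].
  by move=> /setIdP[_ /eqP /= ->] [-> ->].
have cb3 : (#|bad3| <= #|setX X X|)%N.
  apply: (@card_inj_leq _ _ _ _ (fun u => (u.1, u.2.1))).
    by move=> u; rewrite inE => /andP[/X3P[u1 u2 _] _]; rewrite in_setX u1.
  move=> [x [y z]] [x' [y' z']] /setIdP[_ /eqP /= ->].
  by move=> /setIdP[_ /eqP /= ->] [-> ->].
have cb4 : (#|bad4| <= #|setX X X|)%N.
  apply: (@card_inj_leq _ _ _ _ (fun u => (u.1, u.2.1))).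
    by move=> u; rewrite inE => /andP[/X3P[u1 u2 _] _]; rewrite in_setX u1.
  move=> [x [y z]] [x' [y' z']] /setIdP[_ /eqP /= ->].
  by move=> /setIdP[_ /eqP /= ->] [-> ->].
have goodP u : u \in good -> [/\ u \in X3, ~~ share_line co u.1 u.2.1, u.2.1 != u.1,
    u.2.2 != u.1 & u.2.2 != u.2.1].
  rewrite in_setD !in_setU !negb_or => /andP[/and4P[b1 b2 b3 b4] uX].
  have nb (P : pred (gT * (gT * gT))) : u \notin [set v in X3 | P v] -> ~~ P u.
    by apply: contra => Pu; rewrite inE uX.
  by move: b1 b2 b3 b4 => /nb b1 /nb b2 /nb b3 /nb b4.
have cg : (#|good| <= 2 * #|setX (B ^+ 2)%g (B ^+ 2)%g|)%N.
  have BB x y : x \in X -> y \in X -> (x^-1 * y)%g \in (B ^+ 2)%g.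
    move=> /XP[xB _] /XP[yB _]; apply: (@mem_expg_mul _ B 1 1); rewrite expg1 //.
    by rewrite -BV memV_invg.
  pose f (u : gT * (gT * gT)) := (u.1^-1 * u.2.1, u.1^-1 * u.2.2)%g.
  apply: (@card_fibre_leq _ _ _ _ f) => [u /goodP[/X3P[u1 u2 u3] _ _ _ _]|u0 /goodP].
    by rewrite in_setX !BB.
  case=> /X3P[/XP[_ x1] /XP[_ x2] /XP[_ x3]] nsh n12 n13 n23.
  set Fib := finset _.
  (* A triple with the same image as [u0] is a left translate of [u0]; by [translate_unique] at most
     one translating element differs from 1. *)
  have FibP u : u \in Fib -> let g := (u.1 * u0.1^-1)%g in
     [/\ tr (g * u0.1)%g = s, tr (g * u0.2.1)%g = s & tr (g * u0.2.2)%g = s] /\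
     u = (g * u0.1, (g * u0.2.1, g * u0.2.2))%g.
    move=> /setIdP[/goodP[/X3P[/XP[_ y1] /XP[_ y2] /XP[_ y3]] _ _ _ _] /eqP[E2 E3]] /=.
    rewrite mulgKV -!mulgA -E2 -E3 !mulKVg; split=> //.
    by case: (u) => ? [].
  have [sub|[u1]] := set_0Vmem (Fib :\ u0).
    apply: (@card_leq2 _ _ u0 u0) => u uF; left; apply/eqP; apply: contraT => uu0.
    by have := in_set0 u; rewrite -sub in_setD1 uu0 uF.
  rewrite in_setD1 => /andP[n1 /FibP[t1 E1]].
  apply: (@card_leq2 _ _ u0 u1) => u /FibP[tu Eu].
  have [|nu] := eqVneq u u0; first by left.
  have ne v :
     v = (v.1 * u0.1^-1 * u0.1, (v.1 * u0.1^-1 * u0.2.1, v.1 * u0.1^-1 * u0.2.2))%g ->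
     v != u0 -> (v.1 * u0.1^-1 != 1)%g.
    move=> Ev; apply: contraNneq => v1; rewrite Ev v1 !mul1g; case: (u0) => ? [] //.
  right; rewrite Eu E1.
  by rewrite (translate_unique s0 x1 x2 x3 n12 n13 n23 nsh tu (ne _ Eu nu) t1 (ne _ E1 n1)).
have cB2 : (#|(B ^+ 2)%g| <= K)%N by apply/subset_leq_card/expg_sub_leq.
have cX3 : (#|X3| <= #|good| + (#|bad1| + (#|bad2| + (#|bad3| + #|bad4|))))%N.
  rewrite -(cardsID (bad1 :|: (bad2 :|: (bad3 :|: bad4))) X3) addnC leq_add2l.
  apply: leq_trans (subset_leq_card (subsetIr _ _)) _.
  do 3![apply: leq_trans (leq_card_setU _ _) _; rewrite leq_add2l].
  by [].
rewrite /X3 !cardsX in cX3 cb1 cb2 cb3 cb4 cg.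
have n8 : (#|X| %/ 8 * 8 <= #|X|)%N := leq_trunc_div _ _.
have cB4 := leq_mul cB2 cB2.
move: (#|X|) (#|X| %/ 8)%N n8 cb1 cb2 cb3 cb4 cX3 => n r n8 cb1 cb2 cb3 cb4 cX3.
have c1 : (4 * (2 * r * (n * n)) <= n * (n * n))%N by rewrite mulnA leq_mul //; lia.
have K2 : (0 < K * K)%N by rewrite muln_gt0 K0.
rewrite -mulnn !expnS expn0 !muln1.
(* From 12 on, the three sets of triples with a repeated entry make up at most another quarter, so
   half of all triples are good. Below 12 the constant alone suffices. *)
have [n12|n12] := leqP 12 n.
  have c2 : (12 * (n * n) <= n * (n * n))%N by rewrite leq_mul.
  by lia.
have : (n * (n * n) <= 11 * (11 * 11))%N by rewrite !leq_mul.
by lia.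
Qed.
End TraceFibre.

(** * Escape from exceptional traces *)

Section Escape.
Variables (F : finFieldType) (gT : finGroupType) (co : sl2_coords F gT).
Implicit Types (x y z g : gT).
Local Notation a := (ea co).
Local Notation b := (eb co).
Local Notation c := (ec co).
Local Notation d := (ed co).
Local Notation tr := (sl2_tr co).

Definition sl2_mx x : 'M[F]_2 :=
  \matrix_(i, j) (if i == 0 then if j == 0 then a x else b x
                  else if j == 0 then c x else d x).

Lemma sl2_mxM x y : sl2_mx (x * y)%g = sl2_mx x *m sl2_mx y.
Proof.
apply/matrixP => i j; rewrite !mxE !big_ord_recl big_ord0 !mxE /= !sl2_M addr0.
by case: (i == 0); case: (j == 0).
Qed.

Lemma sl2_mx1 : sl2_mx 1%g = 1%:M.
Proof.
apply/matrixP => i j; rewrite !mxE !sl2_1.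
by case: i j => [[|[|//]] ?] [[|[|//]] ?].
Qed.

Lemma sl2_mx_tr x : \tr (sl2_mx x) = tr x.
Proof. by rewrite /mxtrace !big_ord_recl big_ord0 !mxE /= addr0. Qed.

Lemma sl2_mx_inj : injective sl2_mx.
Proof.
move=> x y E; have e i j : sl2_mx x i j = sl2_mx y i j by rewrite E.
by apply: (@sl2_inj _ _ co); [have := e 0 0 | have := e 0 1 | have := e 1 0
  | have := e 1 1]; rewrite !mxE.
Qed.

Lemma sl2_mx_span (W : {vspace 'M[F]_2}) :
  (forall x, sl2_mx x \in W) -> W = fullv.
Proof.
move=> HW; apply/eqP; rewrite eqEsubv subvf /=; apply/subvP => m _.
have [|u [au bu cu du]] := @sl2_surj _ _ co 1 1 0 1; first by ring.
have [|l [al bl cl dl]] := @sl2_surj _ _ co 1 0 1 1; first by ring.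
(* The group elements [u l], [u], [l] and 1 span the 2 x 2 matrices. *)
have -> : m = (m 0 0 - m 1 1) *: sl2_mx (u * l)%g + (m 0 1 - (m 0 0 - m 1 1)) *: sl2_mx u
  + (m 1 0 - (m 0 0 - m 1 1)) *: sl2_mx l
  + (m 0 0 - m 0 1 - m 1 0) *: sl2_mx 1%g.
  apply/matrixP => i j; rewrite !mxE !sl2_M !sl2_1 au bu cu du al bl cl dl.
  case: i j => [[|[|//]] Hi] [[|[|//]] Hj] /=;
  [ have -> : Ordinal Hi = 0 by apply: val_inj
  | have -> : Ordinal Hi = 0 by apply: val_inj
  | have -> : Ordinal Hi = 1 by apply: val_inj
  | have -> : Ordinal Hi = 1 by apply: val_inj];
  [ have -> : Ordinal Hj = 0 by apply: val_inj
  | have -> : Ordinal Hj = 1 by apply: val_inj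
  | have -> : Ordinal Hj = 0 by apply: val_inj
  | have -> : Ordinal Hj = 1 by apply: val_inj]; ring.
by rewrite !memvD // memvZ.
Qed.

Variable A : {set gT}.
Hypotheses (genA : <<A>>%g = [set: gT]) (A1 : 1%g \in A).

(** If going from [A ^ i] to [A ^ (i + 1)] adds no new direction, the span is stable under right
    multiplication by [A], hence contains the whole group and has dimension 4. So up to dimension 4
    each step adds a vector. *)
Lemma expg_free_basis i : (i < 4)%N -> exists X : seq gT,
  [/\ size X = i.+1, {subset X <= (A ^+ i)%g}, 1%g \in X & free (map sl2_mx X)].
Proof.
elim: i => [|i IHi] i4.
  exists [:: 1%g]; split=> //.
    by move=> x; rewrite inE => /eqP ->; rewrite expg0 set11.
    by rewrite inE.
  by rewrite /= seq1_free sl2_mx1 -mxrank_eq0 mxrank1.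
have [X [sX XA X1 fX]] := IHi (ltnW i4).
pose W := <<map sl2_mx X>>%VS.
have [/existsP[x /andP[xA xW]]|N] :=
    boolP [exists x, (x \in (A ^+ i.+1)%g) && (sl2_mx x \notin W)].
  exists (x :: X); split; rewrite /= ?sX //.
  - move=> y; rewrite inE => /predU1P[-> //|/XA yA].
    by apply: (subsetP (expg_sub_leq A1 (leqnSn i))).
  - by rewrite inE X1 orbT.
  by rewrite free_cons xW.
have AW x : x \in (A ^+ i.+1)%g -> sl2_mx x \in W.
  move=> xA; apply: contraNT N => xW; apply/existsP; exists x; by rewrite xA.
have stab g m : g \in A -> m \in W -> m *m sl2_mx g \in W.
  move=> gA mW; pose f := linfun (mulmxr (sl2_mx g)) : 'End('M[F]_2).
  have -> : m *m sl2_mx g = f m by rewrite lfunE.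
  have : f m \in (f @: W)%VS by apply: memv_img.
  apply: subvP; rewrite limg_span; apply/span_subvP => _ /mapP[_ /mapP[x xX ->] ->].
  by rewrite lfunE /= -sl2_mxM AW // expgSr mem_mulg ?XA.
have WT : W = fullv.
  apply: sl2_mx_span => x; have : x \in [set y | sl2_mx y \in W]; last by rewrite inE.
  have -> : [set y | sl2_mx y \in W] = [set: gT]; last by rewrite inE.
  apply: (gen_stable_set genA) => [|y g]; first by rewrite inE memv_span // map_f.
  by rewrite !inE sl2_mxM => yW gA; apply: stab.
have : (\dim W <= size (map sl2_mx X))%N by apply: dim_span.
by rewrite WT dimvf dim_matrix size_map sX; move: i4; lia.
Qed.

(** Here 81 is 3 ^ 4: with only three traces available in [A ^ 4], the four traces [tr (g x_i)] take
    at most 81 values, and they determine [g] because the trace form is nondegenerate. *)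
Lemma escape_good : (81 < #|A|)%N -> exists2 x, x \in (A ^+ 4)%g & sl2_good co x.
Proof.
move=> N81; have [/exists_inP //|Nx] := boolP [exists x in (A ^+ 4)%g, sl2_good co x].
have [X [sX XA X1 fX]] := expg_free_basis (isT : 3 < 4)%N.
have spanX : <<map sl2_mx X>>%VS = fullv.
  apply/eqP; rewrite -dimv_leqif_eq ?subvf //= dimvf dim_matrix.
  by rewrite (eqP fX) size_map sX.
pose S : {set F} := [set 0; 2; -2].
have S3 : (#|S| <= 3)%N.
  rewrite /S; apply: leq_trans (leq_card_setU _ _) _; rewrite cards1 addn1 ltnS.
  by rewrite cards2; case: (_ == _).
have AS x : x \in (A ^+ 4)%g -> tr x \in S.
  move=> xA; move: Nx; rewrite negb_exists => /forallP/(_ x); rewrite xA /=.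
  rewrite negb_and !negbK !inE => /orP[/eqP e4|->] //.
  have: (tr x - 2) * (tr x + 2) = 0 by apply: (lin_comb e4); ring.
  by move/eqP; rewrite mulf_eq0 subr_eq0 addr_eq0 -orbA => ->; rewrite orbT.
pose f g : {ffun 'I_4 -> F} := [ffun i : 'I_4 => tr (g * nth 1%g X i)%g].
have : (#|A| <= #|[set u : {ffun 'I_4 -> F} | u \in ffun_on (mem S)]|)%N.
  apply: (@card_inj_leq _ _ _ _ f).
    move=> g gA; rewrite inE; apply/ffun_onP => i; rewrite ffunE; apply: AS.
    apply: (@mem_expg_mul _ A 1 3); first by rewrite expg1.
    by apply: XA; rewrite mem_nth // sX.
  move=> g g' _ _ /ffunP E; apply: sl2_mx_inj; apply/eqP; rewrite -subr_eq0.
  pose D := sl2_mx g - sl2_mx g'.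
  have D0 m : \tr (D *m m) = 0.
    have : m \in <<map sl2_mx X>>%VS by rewrite spanX memvf.
    move=> /(@coord_span _ _ _ (in_tuple _)) ->.
    rewrite linear_sum raddf_sum big1 // => i _ /=.
    have Xi : (i < 4)%N by rewrite -[4%N]sX -(size_map sl2_mx).
    rewrite -scalemxAr mxtraceZ (nth_map 1%g) ?sX //.
    have := E (Ordinal Xi); rewrite !ffunE /= -!sl2_mx_tr !sl2_mxM => e.
    by rewrite mulmxBl raddfB /= e subrr mulr0.
  (* Pairing [D] with an elementary matrix extracts one entry. *)
  apply/eqP/matrixP => i j; have := D0 (delta_mx j i).
  rewrite -/D mxE /mxtrace (bigD1 i) //= big1 => [|k ki].
    rewrite addr0 mxE (bigD1 j) //= big1 => [|l lj]; rewrite !mxE ?eqxx ?mulr1 ?addr0 //.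
    by rewrite (negPf lj) mulr0.
  by rewrite mxE big1 // => l _; rewrite [delta_mx _ _ _ _]mxE (negPf ki) andbF mulr0.
move=> N; have NS : (#|A| <= #|S| ^ 4)%N.
  by apply: leq_trans N _; rewrite cardsE card_ffun_on card_ord.
have S81 : (#|S| ^ 4 <= 3 ^ 4)%N by rewrite leq_exp2r.
by have := leq_trans N81 (leq_trans NS S81).
Qed.
End Escape.

(** * Growth *)

Section Growth.
Variables (F : finFieldType) (gT : finGroupType) (co : sl2_coords F gT).
Implicit Types (x y z g : gT).
Local Notation tr := (sl2_tr co).
Variable A : {set gT}.
Hypotheses (genA : <<A>>%g = [set: gT]) (A1 : 1%g \in A) (AV : (A^-1)%g = A).

(** The exponent is 4 (4 + 2): [orbit_bound] needs the fourth power of [A ^ (j + 2)] for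
    [j <= 4]. *)
Let M := #|(A ^+ 24)%g|.
Let torus y := (A ^+ 2 :&: 'C[y])%g.

(** Conjugating [z] by [A] stays among the elements of trace [tr z] in [A ^ (j + 2)], which
    [larsen_pink] counts; each fibre is a translate of part of the torus. *)
Lemma orbit_bound j z : (j <= 4)%N -> z \in (A ^+ j)%g -> sl2_good co z ->
  (#|A| ^ 3 <= 2 ^ 16 * #|torus z| ^ 3 * M ^ 2)%N.
Proof.
move=> j4 zA /andP[rz tz]; set B := (A ^+ j.+2)%g.
have B1 : 1%g \in B by apply: expg_one_mem.
have BV : (B^-1)%g = B by apply: expg_symm.
have AB : A \subset B by apply: sub_expg.
have genB : <<B>>%g = [set: gT].
  by apply/eqP; rewrite eqEsubset subsetT -genA genS.
have LP := larsen_pink co genB B1 BV tz rz; set X := finset _ in LP.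
have BM : (#|(B ^+ 4)%g| <= M)%N.
  by rewrite -expgM; apply/subset_leq_card/expg_sub_leq => //; lia.
have orb : (#|A| <= #|torus z| * #|X|)%N.
  apply: (@card_fibre_leq _ _ _ _ (fun x => z ^ x)%g) => [x xA|x0 x0A].
    rewrite inE sl2_trJ eqxx andbT conjgE.
    apply: (@mem_expg_mul _ A 1 j.+1); first by rewrite expg1 -AV memV_invg.
    by rewrite -addn1; apply: mem_expg_mul; rewrite ?expg1.
  apply: (@card_inj_leq _ _ _ _ (fun x => x * x0^-1)%g) => [x|x y _ _ /mulIg //].
  case/setIdP => xA /eqP E; rewrite /torus in_setI.
  rewrite (@mem_expg_mul _ A 1 1) ?expg1 //=; last first.
    by rewrite -AV memV_invg.
  apply/cent1P/commute_sym/commgP/conjg_fixP.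
  by rewrite conjgM E -conjgM mulgV conjg1.
apply: leq_trans (_ : (#|torus z| * #|X|) ^ 3 <= _)%N; first by rewrite leq_exp2r.
rewrite expnMn -mulnA mulnCA leq_mul2l; apply/orP; right.
by apply: leq_trans LP _; rewrite leq_mul2l leq_sqr BM orbT.
Qed.

(** At most 4 elements of a torus are bad, so a fifth one is good and has the same centralizer;
    [orbit_bound] applies to it. *)
Lemma rich_torus y : sl2_regular co y -> (4 < #|torus y|)%N ->
  (#|A| ^ 3 <= 2 ^ 16 * #|torus y| ^ 3 * M ^ 2)%N.
Proof.
move=> ry Ly.
have [/exists_inP[z]|N] := boolP [exists z in torus y, sl2_good co z].
  rewrite inE => /andP[zA zy] gz; have /andP[rz _] := gz.
  by have := orbit_bound (isT : 2 <= 4)%N zA gz; rewrite /torus (cent1_regular_eq ry rz zy).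
have /subset_leq_card : torus y \subset [set x in 'C[y]%g | ~~ sl2_good co x].
  apply/subsetP => x xy; rewrite inE; move: (xy); rewrite inE => /andP[_ ->] /=.
  by apply: contra N => gx; apply/exists_inP; exists x.
by move=> H; have := leq_trans (leq_trans Ly H) (card_cent1_bad ry).
Qed.

(** The products [x (t ^ g)] lie in [A ^ 5]. Two of them agree only if [x0^-1 x] lies in the poor
    torus of [y ^ g], so fibres have at most 4 elements. *)
Lemma pivot y g : sl2_regular co y -> g \in A -> (#|torus (y ^ g)%g| <= 4)%N ->
  (#|A| * #|torus y| <= 4 * M)%N.
Proof.
move=> ry gA L4; rewrite -cardsX.
have gVA : (g^-1)%g \in A by rewrite -AV memV_invg.
apply: leq_trans (_ : 4 * #|(A ^+ 5)%g| <= _)%N; last first.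
  by rewrite leq_mul2l /=; apply/subset_leq_card/expg_sub_leq.
apply: (@card_fibre_leq _ _ _ _ (fun u => u.1 * u.2 ^ g)%g).
  case=> x t /setXP[/= xA]; rewrite inE conjgE => /andP[tA _].
  apply: (@mem_expg_mul _ A 1 4); first by rewrite expg1.
  apply: (@mem_expg_mul _ A 1 3); first by rewrite expg1.
  by apply: (@mem_expg_mul _ A 2 1); rewrite ?expg1.
case=> x0 t0 /setXP[/= x0A t0y]; apply: leq_trans L4.
have E x t : (x * t ^ g = x0 * t0 ^ g)%g -> (x0^-1 * x = (t0 * t^-1) ^ g)%g.
  move=> e; rewrite conjMg conjVg; apply: (mulIg (t ^ g)%g).
  by rewrite mulgKV -mulgA e mulKg.
apply: (@card_inj_leq _ _ _ _ (fun u => x0^-1 * u.1)%g).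
  case=> x t /setIdP[/setXP[/= xA ty] /eqP /E e]; rewrite inE.
  rewrite (@mem_expg_mul _ A 1 1) ?expg1 //=; last by rewrite -AV memV_invg.
  rewrite e cent1J memJ_conjg; apply: groupM; first by case/setIP: t0y.
  by rewrite groupV; case/setIP: ty.
move=> [x t] [x' t'] /setIdP[_ /eqP /= e] /setIdP[_ /eqP /= e'] /mulgI xx.
by move: e; rewrite -e' xx => /mulgI /conjg_inj ->.
Qed.

(** Double counting of pairs ([z], [x]) with [z] conjugate to [y] and [x] good in the torus of [z].
    Each [x] occurs at most twice, since [z] lies in the torus [C[x]] and has prescribed trace. As
    the class has at least [|F|^2 / 4] elements, this bounds the smallest torus size [L], which
    [rich_torus] compares with [|A|]. *)
Lemma all_rich y : sl2_regular co y ->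
    (forall g, 4 < #|torus (y ^ g)%g|)%N ->
  (#|A| ^ 3 * #|F| ^ 6 <= 2 ^ 32 * M ^ 5)%N.
Proof.
move=> ry rich; pose cl := (y ^: [set: gT])%g.
have ycl : y \in cl by apply: class_refl.
have [y0 y0cl ymin] := arg_minnP (fun z => #|torus z|) ycl.
have clP z : z \in cl -> [/\ sl2_regular co z, tr z = tr y & 4 < #|torus z|]%N.
  by case/imsetP => g _ ->; rewrite sl2_regularJ sl2_trJ.
have [ry0 _ L4] := clP _ y0cl; set L := #|torus y0| in L4 ymin.
have H1 : ((L - 4) * #|cl| <= 2 * M)%N.
  pose D := [set u : gT * gT | (u.1 \in cl) && (u.2 \in torus u.1) && sl2_good co u.2].
  apply: (@leq_trans #|D|).
    apply: (@card_fibre_geq _ _ _ _ fst) => z zcl; have [rz _ _] := clP _ zcl.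
    apply: (@leq_trans #|[set x in torus z | sl2_good co x]|).
      rewrite leq_subLR -(leq_add2r (L - 4)).
      apply: leq_trans (_ : L + (L - 4) <= _)%N => //.
      rewrite leq_add2r; apply: leq_trans (ymin _ zcl) _.
      rewrite -(cardsID [set x | sl2_good co x] (torus z)) addnC.
      apply: leq_add; last first.
        by apply/subset_leq_card/subsetP => x; rewrite !inE.
      apply: leq_trans (card_cent1_bad rz); apply/subset_leq_card/subsetP => x.
      by rewrite !inE => /andP[-> /andP[_ ->]].
    apply: (@card_inj_leq _ _ _ _ (fun x => (z, x))) => [x|x x' _ _ [] //].
    case/setIdP => xz gx; rewrite !inE /= eqxx zcl gx -[_ && _]andbT.
    by move: xz; rewrite !inE => ->.
  apply: leq_trans (_ : 2 * #|(A ^+ 2)%g| <= _)%N; last first.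
    by rewrite leq_mul2l /=; apply/subset_leq_card/expg_sub_leq.
  apply: (@card_fibre_leq _ _ _ _ snd) => [[z x]|[z0 x0]].
    by rewrite inE /= => /andP[/andP[_ /setIP[]]].
  rewrite inE /= => /andP[/andP[/clP[rz0 tz0 _] /setIP[_ xz0]] /andP[rx _]].
  apply: leq_trans (card_cent1_trace (tr y) rx).
  apply: (@card_inj_leq _ _ _ _ fst).
    case=> z x; rewrite inE /= => /andP[zD /eqP xx0]; move: zD; rewrite xx0 inE /=.
    move=> /andP[/andP[/clP[_ tz _] /setIP[_ xz]] _]; rewrite inE tz eqxx andbT.
    by rewrite cent1C.
  by move=> [z x] [z' x'] /setIdP[_ /eqP /= ->] /setIdP[_ /eqP /= ->] /= ->.
have H2 : (#|gT| <= #|cl| * (2 * #|F|))%N.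
  rewrite -index_cent1 setTI -cardsT -(Lagrange (subsetT 'C[y]%G)) mulnC /=.
  by rewrite leq_mul2l (card_cent1_leq ry) orbT.
have H3 := card_sl2_geq co.
have q2 : (1 < #|F|)%N by apply: card_finNzRing_gt1.
have H4 : (#|F| ^ 2 <= 4 * #|cl|)%N.
  have : (#|F| * ((#|F| - 1) * #|F|) <= #|F| * (#|cl| * 2))%N.
    by move: (leq_trans H3 H2); rewrite -mulnn; lia.
  by rewrite leq_pmul2l ?(ltnW q2) // -mulnn; nia.
(* Since [L >= 5], [L <= 5 (L - 4)]; hence 40 = 4 * 5 * 2. *)
have H5 : (#|F| ^ 2 * L <= 40 * M)%N.
  have : (#|F| ^ 2 * L <= 4 * #|cl| * (5 * (L - 4)))%N by apply: leq_mul => //; lia.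
  by move: H1; lia.
have H6 := rich_torus ry0 L4; rewrite -/L in H6.
have H6' : (#|A| ^ 3 * #|F| ^ 6 <= 2 ^ 16 * L ^ 3 * M ^ 2 * (#|F| ^ 2) ^ 3)%N.
  by rewrite -expnM leq_mul2r H6 orbT.
have H7 : ((#|F| ^ 2 * L) ^ 3 <= (40 * M) ^ 3)%N by rewrite leq_exp2r.
rewrite (expnMn (_ ^ 2)%N L) (expnMn 40) in H7.
have H8 : (40 ^ 3 <= 2 ^ 16)%N by lia.
have gen p k l f m3 m2 : (f * l <= k * m3 -> k <= p ->
    p * l * m2 * f <= p * p * (m3 * m2))%N.
  move=> fl kp; have -> : (p * l * m2 * f = p * m2 * (f * l))%N by lia.
  have -> : (p * p * (m3 * m2) = p * m2 * (p * m3))%N by lia.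
  by rewrite leq_mul2l (leq_trans fl) ?orbT // leq_mul2r kp orbT.
have H9 := leq_trans H6' (gen _ _ _ _ _ (M ^ 2)%N H7 H8).
rewrite -(expnD 2) -(expnD M) in H9; exact: H9.
Qed.

(** The first bound is the product of [|A|^3 <= 2^16 L^3 M^2] and [(|A| L)^3 <= (4 M)^3] for a torus
    of size [L]. Such a torus is that of [x0] if it is poor, or else a rich conjugate with a poor
    neighbour. If there is no poor conjugate, [all_rich] applies. *)
Lemma growth_dichotomy : (81 < #|A|)%N ->
  (#|A| ^ 6 <= 2 ^ 22 * M ^ 5)%N \/ (#|A| ^ 3 * #|F| ^ 6 <= 2 ^ 32 * M ^ 5)%N.
Proof.
move=> N81; have [x0 x0A gx0] := escape_good co genA A1 N81.
have /andP[rx0 _] := gx0.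
have NM : (#|A| <= M)%N.
  by apply/subset_leq_card/sub_expg.
have fin y : (#|A| ^ 3 <= 2 ^ 16 * #|torus y| ^ 3 * M ^ 2)%N ->
    (#|A| * #|torus y| <= 4 * M)%N -> (#|A| ^ 6 <= 2 ^ 22 * M ^ 5)%N.
  move=> H1 H2; have H3 : ((#|A| * #|torus y|) ^ 3 <= (4 * M) ^ 3)%N by rewrite leq_exp2r.
  rewrite (expnMn #|A|) (expnMn 4) in H3.
  have gen n l p f m3 m2 : (n <= p * l * m2 -> n * l <= f * m3 ->
      n * n <= p * f * (m3 * m2))%N.
    move=> h1 h3; apply: leq_trans (leq_mul (leqnn n) h1) _.
    have -> : (n * (p * l * m2) = p * m2 * (n * l))%N by lia.
    have -> : (p * f * (m3 * m2) = p * m2 * (f * m3))%N by lia.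
    by rewrite leq_mul2l h3 orbT.
  have c22 : (2 ^ 16 * 4 ^ 3 = 2 ^ 22)%N by lia.
  have := gen _ _ _ _ _ _ H1 H3; rewrite -(expnD #|A|) -(expnD M) c22; exact: id.
have [L4|L4] := leqP #|torus x0| 4.
  left; apply: (fin x0); first exact: orbit_bound x0A gx0.
  by rewrite mulnC; apply: leq_mul.
pose P := [set g | 4 < #|torus (x0 ^ g)%g|]%N.
have P1 : 1%g \in P by rewrite inE conjg1.
have [/existsP[g gP]|N] := boolP [exists g, g \notin P].
  have [g0 [g1 [g0P g1A NP]]] := gen_escape genA P1 gP; left.
  rewrite !inE -leqNgt in g0P NP.
  have ry : sl2_regular co (x0 ^ g0)%g by rewrite sl2_regularJ.
  apply: (fin (x0 ^ g0)%g); first exact: rich_torus.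
  by apply: (pivot ry g1A); rewrite -conjgM.
right; apply: (all_rich rx0) => g.
have : g \in P by apply: contraNT N => gP; apply/existsP; exists g.
by rewrite inE.
Qed.
End Growth.

(** * Large sets *)

(* Second moment of the number of points of [X x Z] on the line [x y + z = w], over
   all lines [(y, w)]. *)
Lemma incidence (F : finFieldType) (X Z Y W : {set F}) :
    (#|F| ^ 3 < #|X| * #|Z| * (#|Y| * #|W|))%N ->
  exists x y z w, [/\ x \in X, y \in Y, z \in Z, w \in W & x * y + z = w].
Proof.
move=> big; set q := #|F| in big; pose P := setX X Z; pose n := #|P|.
have [/existsP[u /existsP[v /and4P[uP vY vW /eqP E]]]|none] := boolP [exists u : F * F,
    exists v : F * F, [&& u \in P, v.1 \in Y, v.2 \in W & u.1 * v.1 + u.2 == v.2]].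
  move: uP; rewrite (surjective_pairing u) => /setXP[uX uZ].
  by exists u.1, v.1, u.2, v.2.
pose N (v : F * F) := (\sum_(u in P) (u.1 * v.1 + u.2 == v.2)%R)%N.
have one (y s : F) : (\sum_(w : F) (s == w) = 1)%N.
  by rewrite (bigD1 s) //= eqxx big1 // => w; rewrite eq_sym => /negPf ->.
have sumN : (\sum_v N v = q * n)%N.
  rewrite exchange_big /= (eq_bigr (fun=> q)) => [|u _].
    by rewrite sum_nat_const mulnC.
  rewrite -(pair_bigA _ (fun y w => nat_of_bool (u.1 * y + u.2 == w))) /=.
  rewrite (eq_bigr (fun=> 1%N)) => [|y _]; last exact: one.
  by rewrite sum1_card.
have sumN2 : (\sum_v N v * N v <= n * (q + n))%N.
  have -> : (\sum_v N v * N v = \sum_(u in P) \sum_(u' in P) \sum_(y : F)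
      (u.1 * y + u.2 == u'.1 * y + u'.2)%R)%N.
    rewrite -(pair_bigA _ (fun y w => N (y, w) * N (y, w))%N) /=.
    under [RHS]eq_bigr => u _ do rewrite exchange_big /=.
    rewrite [RHS]exchange_big /=; apply: eq_bigr => y _.
    rewrite (eq_bigr (fun w => \sum_(u in P) \sum_(u' in P)
      (u.1 * y + u.2 == w)%R * (u'.1 * y + u'.2 == w)%R)%N) => [|w _]; last first.
      by rewrite big_distrl /=; apply: eq_bigr => u _; rewrite big_distrr.
    rewrite exchange_big /=; apply: eq_bigr => u _; rewrite exchange_big /=.
    apply: eq_bigr => u' _; rewrite (bigD1 (u.1 * y + u.2)) //= eqxx mul1n.
    by rewrite big1 ?addn0 1?eq_sym // => w; rewrite eq_sym => /negPf ->.
  rewrite -sum_nat_const; apply: leq_sum => u uP.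
  rewrite (bigD1 u) //=; apply: leq_add.
    by rewrite (eq_bigr (fun=> 1%N)) ?sum1_card // => y _; rewrite eqxx.
  apply: leq_trans (_ : \sum_(u' in P) 1 <= _)%N; last by rewrite sum1_card.
  rewrite [X in (_ <= X)%N](bigD1 u) //=; apply: leq_trans (leq_addl _ _).
  apply: leq_sum => u' /andP[_ uu'].
  (* Two distinct points are joined by at most one line ([y], [w]). *)
  have [/existsP[y0 y0E]|Ny] := boolP [exists y, u.1 * y + u.2 == u'.1 * y + u'.2];
      last first.
    rewrite big1 // => y _; case: eqP => // e.
    by case/existsP: Ny; exists y; rewrite e.
  rewrite (bigD1 y0) //= y0E big1 // => y yy0; case: eqP => // e.
  case/negP: uu'; have E1 : (u'.1 - u.1) * (y - y0) = 0.
    by apply: (lin_comb ((eqP y0E) (-) e)); ring.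
  move/eqP: E1; rewrite mulf_eq0 !subr_eq0 (negPf yy0) orbF => /eqP e1.
  apply/eqP; move: e e1; case: (u) (u') => [? ?] [? ?] /= e e1.
  by congr pair => //; move: e; rewrite e1 => /addrI.
have sumYW : (\sum_(v : F * F) (v \in setX Y W) = #|Y| * #|W|)%N.
  by rewrite -cardsX -sum1_card [RHS]big_mkcond; apply: eq_bigr => v _; case: (v \in _).
(* This is [(q N v - n)^2 >= 0] expanded; on [Y x W], where [N] vanishes, the whole square [n * n]
   is gained. *)
have pt v : (2 * q * n * N v + n * n * (v \in setX Y W) <= q * q * (N v * N v) + n * n)%N.
  have [vYW|_] := boolP (v \in setX Y W); last first.
    by have [H _] := nat_Cauchy (q * N v) n; move: H; rewrite -!mulnn; lia.
  suff -> : N v = 0%N by lia.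
  rewrite /N big1 // => u uP; case: eqP => // E; case/negP: none.
  apply/existsP; exists u; apply/existsP; exists v.
  by move: vYW; rewrite (surjective_pairing v) in_setX uP E eqxx => /andP[-> ->].
have : (\sum_v (2 * q * n * N v + n * n * (v \in setX Y W)) <=
    \sum_v (q * q * (N v * N v) + n * n))%N by apply: leq_sum => v _; apply: pt.
rewrite !big_split /= -!big_distrr /= sumN sumYW sum_nat_const card_prod -/q => S.
have {}S := leq_trans S (leq_add (leq_mul (leqnn (q * q)) sumN2) (leqnn _)).
move: big; rewrite -cardsX -/P -/n => big; exfalso.
have n0 : (0 < n)%N by rewrite lt0n; apply: contraTneq big => ->; rewrite mul0n.
have : (n * (n * (#|Y| * #|W|)) <= n * q ^ 3)%N by rewrite !expnS expn0 muln1; lia.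
by rewrite leq_pmul2l // leqNgt big.
Qed.

(** * Large sets contain the unipotent subgroups and cover the group *)

Section Endgame.
Variables (F : finFieldType) (gT : finGroupType).
Implicit Types (x y z g : gT) (t : F).

(** Conjugation by the permutation matrix: it exchanges upper and lower triangular matrices, so that
    results on [sl2_U] also serve for the lower unipotent group. *)
Definition sl2_swap (co : sl2_coords F gT) : sl2_coords F gT.
Proof.
refine (@Sl2Coords F gT (ed co) (ec co) (eb co) (ea co) _ _ _ _ _ _ _ (sl2_two_neq0 co)).
- by move=> g; rewrite mulrC sl2_det mulrC.
- by move=> g h; rewrite sl2_dM addrC.
- by move=> g h; rewrite sl2_cM addrC.
- by move=> g h; rewrite sl2_bM addrC.
- by move=> g h; rewrite sl2_aM addrC.
- by move=> g h hd hc hb ha; apply: (sl2_inj (s := co)).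
move=> a b c d E.
have [|g [ga gb gc gd]] := sl2_surj co (a := d) (b := c) (c := b) (d := a).
  by rewrite mulrC E mulrC.
by exists g.
Defined.

Section Unipotent.
Variable co : sl2_coords F gT.
Local Notation a := (ea co).
Local Notation b := (eb co).
Local Notation c := (ec co).
Local Notation d := (ed co).

Definition sl2_D : {set gT} := [set x | (b x == 0) && (c x == 0)].

Lemma sl2_D_group_set : group_set sl2_D.
Proof.
apply/group_setP; split=> [|x y]; first by rewrite inE !sl2_1 !eqxx.
rewrite !inE !(sl2_M co x y) => /andP[/eqP -> /eqP ->] /andP[/eqP -> /eqP ->].
by apply/andP; split; apply/eqP; ring.
Qed.
Canonical sl2_D_group := Group sl2_D_group_set.

Lemma card_sl2_D : (#|F| - 1 <= #|sl2_D|)%N.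
Proof.
have mk t : t != 0 -> let g := sl2_mk co t 0 0 t^-1 in
    [/\ a g = t, b g = 0, c g = 0 & d g = t^-1].
  by move=> t0; apply: sl2_mkE; rewrite mulfV // mul0r addr0.
have -> : (#|F| - 1 = #|[set t : F | t != 0%R]|)%N.
  by rewrite subn1 -(cardC1 (0 : F)) cardsE.
apply: (@card_inj_leq _ _ _ _ (fun t => sl2_mk co t 0 0 t^-1)) => [t|t t'].
  by rewrite !inE => /mk[_ -> -> _]; rewrite eqxx.
by rewrite !inE => /mk[at_ _ _ _] /mk[at' _ _ _] E; rewrite -at_ E at'.
Qed.

(** Conjugation by a diagonal matrix multiplies the upper entry by [a ^+ 2]. So [b x] is sought in
    the form [b x1 * a x2 ^+ 2 + b x3 + b x4] with all [xi] in [B ^ 2], a word of five factors, by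
    [incidence]. *)
Lemma cover_unipotent (B : {set gT}) x : (B^-1)%g = B -> 1%g \in B ->
  (4 * #|F| ^ 11 < #|B| ^ 4)%N -> x \in sl2_U co -> x \in (B ^+ 10)%g.
Proof.
move=> BV B1 big xU; set q := #|F| in big.
have q1 : (1 < q)%N by apply: card_finNzRing_gt1.
have BG (H : {group gT}) : (#|B| * #|H| <= #|B ^+ 2 :&: H| * q ^ 3)%g%N.
  apply: leq_trans (card_subgroup_sqr (E := [set: gT]) BV (subsetT _)) _.
  by rewrite leq_mul2l cardsT card_sl2_leq // orbT.
pose X := [set b y | y in (B ^+ 2 :&: sl2_U co)%g].
pose Y := [set a y ^+ 2 | y in (B ^+ 2 :&: sl2_D)%g].
have cX : (#|B| <= q ^ 2 * #|X|)%N.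
  have -> : #|X| = #|(B ^+ 2 :&: sl2_U co)%g|.
    apply: card_in_imset => y z /setIP[_ /sl2_UP[ay cy dy]] /setIP[_ /sl2_UP[az cz dz]] E.
    by apply: (sl2_inj (s := co)); rewrite ?ay ?cy ?dy ?az ?cz ?dz.
  have := BG (sl2_U_group co); rewrite card_sl2_U -/q expnSr mulnA.
  by rewrite leq_pmul2r ?(ltnW q1) // mulnC.
have cY : (#|B| <= 4 * q ^ 2 * #|Y|)%N.
  have HD := BG sl2_D_group; have D1 := card_sl2_D; rewrite -/q in D1.
  have DY : (#|(B ^+ 2 :&: sl2_D)%g| <= 2 * #|Y|)%N.
    apply: (@card_fibre_leq _ _ _ _ (fun y => a y ^+ 2)) => [y yB|y0 _].
      exact: imset_f.
    apply: leq_trans (_ : #|[set t : F | t ^+ 2 == a y0 ^+ 2]| <= _)%N; last first.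
      apply: (@card_leq2 _ _ (a y0) (- a y0)) => t.
      by rewrite inE eqf_sqr => /orP[] /eqP; tauto.
    apply: (@card_inj_leq _ _ _ _ a) => [y /setIdP[_ E]|y z]; first by rewrite inE.
    move=> /setIdP[/setIP[_ yD] _] /setIdP[/setIP[_ zD] _] E.
    move: yD zD; rewrite !inE => /andP[/eqP by_ /eqP cy] /andP[/eqP bz /eqP cz].
    have Dy := sl2_det co y; have Dz := sl2_det co z.
    rewrite by_ bz !mul0r addr0 in Dy Dz; have ay : a y != 0.
      by apply/eqP => ay; move/eqP: Dy; rewrite ay mul0r eq_sym oner_eq0.
    apply: (sl2_inj (s := co)); rewrite ?by_ ?cy ?bz ?cz //.
    by apply: (mulfI ay); rewrite Dy E Dz.
  have : (#|B| * (q - 1) <= 2 * #|Y| * q ^ 3)%N.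
    apply: leq_trans (leq_mul (leqnn _) D1) (leq_trans HD _).
    by rewrite leq_mul2r DY orbT.
  have q2 : (q <= 2 * (q - 1))%N by lia.
  move=> H; have : (#|B| * q <= 4 * q ^ 2 * #|Y| * q)%N.
    apply: leq_trans (leq_mul (leqnn _) q2) _.
    by move: H; rewrite (expnSr q 2); lia.
  by rewrite leq_pmul2r // ltnW.
(* From [|X| >= |B| / q^2] and [|Y| >= |B| / (4 q^2)]; the 4 in the latter comes from squaring being
   two-to-one and from [q <= 2 (q - 1)]. *)
have XY : (q ^ 3 < #|X| * #|X| * (#|Y| * #|X|))%N.
  have q8 : (0 < 4 * q ^ 8)%N by rewrite muln_gt0 expn_gt0 (ltnW q1).
  rewrite -(ltn_pmul2l q8); apply: leq_trans (_ : #|B| ^ 4 <= _)%N.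
    by apply: leq_trans big; rewrite ltnS -mulnA -expnD.
  have := leq_mul (leq_mul cX cX) (leq_mul cY cX).
  have -> : (q ^ 8 = q ^ 2 * q ^ 2 * (q ^ 2 * q ^ 2))%N by rewrite -!expnD.
  by rewrite !(expnS #|B|) expn0; move: (q ^ 2)%N => r; lia.
(* With this [W], an incidence expresses [b x] as a sum with last term in [X]. *)
pose W := [set b x - t | t in X].
have cW : #|W| = #|X| by apply: card_imset => t t' /addrI /oppr_inj.
have [|t1 [t2 [t3 [t4 [t1X t2Y t3X t4W E]]]]] := @incidence F X X Y W.
  by rewrite cW.
case/imsetP: t1X => x1 /setIP[x1B /sl2_UP[a1 c1 d1]] e1.
case/imsetP: t2Y => x2 /setIP[x2B]; rewrite inE => /andP[/eqP b2 /eqP c2] e2.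
case/imsetP: t3X => x3 /setIP[x3B /sl2_UP[a3 c3 d3]] e3.
case/imsetP: t4W => t5 /imsetP[x4 /setIP[x4B /sl2_UP[a4 c4 d4]] e5] e4.
have x2V : (x2^-1)%g \in (B ^+ 2)%g by apply: expg_inv_mem.
suff -> : x = (x2 * x1 * x2^-1 * x3 * x4)%g.
  apply: (@mem_expg_mul _ B 8 2) => //; apply: (@mem_expg_mul _ B 6 2) => //.
  by apply: (@mem_expg_mul _ B 4 2) => //; apply: (@mem_expg_mul _ B 2 2).
have D2 := sl2_det co x2; rewrite b2 mul0r addr0 in D2.
case/sl2_UP: xU => ax cx dx.
have Ex : b x = b x1 * a x2 ^+ 2 + b x3 + b x4.
  by rewrite -e1 -e2 -e3 E e4 e5 subrK.
apply: (sl2_inj (s := co)); rewrite !(sl2_M, sl2_V) ?ax ?cx ?dx ?Ex;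
  by rewrite ?a1 ?b2 ?c1 ?c2 ?d1 ?a3 ?c3 ?d3 ?a4 ?c4 ?d4; ring: D2.
Qed.
End Unipotent.

(** An element with [c] nonzero is upper times lower times upper unipotent, hence in [B ^ 30]. If
    [c] is 0, one further lower unipotent factor makes it nonzero. *)
Lemma cover_all (co : sl2_coords F gT) (B : {set gT}) : (B^-1)%g = B -> 1%g \in B ->
  (4 * #|F| ^ 11 < #|B| ^ 4)%N -> (B ^+ 40)%g = [set: gT].
Proof.
move=> BV B1 big.
have U x : x \in sl2_U co -> x \in (B ^+ 10)%g by apply: cover_unipotent.
have L x : x \in sl2_U (sl2_swap co) -> x \in (B ^+ 10)%g by apply: cover_unipotent.
have mkU t : exists x,
    [/\ ea co x = 1, eb co x = t, ec co x = 0, ed co x = 1 & x \in (B ^+ 10)%g].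
  have [|x [ax bx cx dx]] := @sl2_surj _ _ co 1 t 0 1; first by ring.
  by exists x; split=> //; apply: U; rewrite inE ax cx !eqxx.
have mkL t : exists x,
    [/\ ea co x = 1, eb co x = 0, ec co x = t, ed co x = 1 & x \in (B ^+ 10)%g].
  have [|x [ax bx cx dx]] := @sl2_surj _ _ co 1 0 t 1; first by ring.
  by exists x; split=> //; apply: L; rewrite inE /= dx bx !eqxx.
have c_neq0 g : ec co g != 0 -> g \in (B ^+ 30)%g.
  move=> c0; have [x [ax bx cx dx xB]] := mkU ((ea co g - 1) / ec co g).
  have [y [ay by_ cy dy yB]] := mkL (ec co g).
  have [z [az bz cz dz zB]] := mkU ((ed co g - 1) / ec co g).
  suff -> : g = (x * y * z)%g.
    by apply: (@mem_expg_mul _ B 20 10) => //; apply: (@mem_expg_mul _ B 10 10).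
  have D := sl2_det co g.
  have bg : eb co g = (ea co g * ed co g - 1) / ec co g by rewrite D addrC addKr mulfK.
  apply: (sl2_inj (s := co)); 
    rewrite !sl2_M ?bg ?ax ?bx ?cx ?dx ?ay ?by_ ?cy ?dy ?az ?bz ?cz ?dz;
    by field.
apply/eqP; rewrite eqEsubset subsetT; apply/subsetP => g _.
have [c0|c0] := eqVneq (ec co g) 0; last first.
  by apply: (subsetP (expg_sub_leq (m := 30) B1 _)); rewrite // c_neq0.
have [y [ay by_ cy dy yB]] := mkL 1.
rewrite -[g](mulgK y); apply: (@mem_expg_mul _ B 30 10).
  apply: c_neq0; rewrite sl2_M c0 cy ay mul0r add0r mulr1.
  apply/eqP => d0; have := sl2_det co g; rewrite c0 d0 !mulr0 addr0.
  by move/esym/eqP; rewrite oner_eq0.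
exact: expg_inv_mem.
Qed.
End Endgame.

(** * Diameter *)

Local Open Scope nat_scope.

Definition sym_gen (gT : finGroupType) (A : {set gT}) : Prop :=
  [/\ <<A>>%g = [set: gT], 1%g \in A & (A^-1)%g = A].

Lemma sym_gen_expg (gT : finGroupType) (A : {set gT}) n :
  0 < n -> sym_gen A -> sym_gen (A ^+ n)%g.
Proof.
move=> n0 [genA A1 AV]; split; [|exact: expg_one_mem | exact: expg_symm].
by apply/eqP; rewrite eqEsubset subsetT -genA genS // sub_expg.
Qed.

(** The first two binomial terms. For [k = n] they give [2 n^n <= (n + 1)^n], so that [n] growth
    steps of exponent [(n + 1) / n] square the cardinality. *)
Lemma leq_expS_mul n k : n ^ k + k * n ^ k.-1 <= n.+1 ^ k.
Proof.
elim: k => [|[|k] IHk]; [by rewrite !expn0 | by rewrite !expn1 expn0; lia |].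
rewrite (expnS n.+1); apply: leq_trans (leq_mul (leqnn n.+1) IHk).
rewrite /= !(expnS n); move: (n ^ k) => X; nia.
Qed.

Lemma leq_exp_base m n e : m <= n -> m ^ e <= n ^ e.
Proof. by case: e => // e mn; rewrite leq_exp2r. Qed.

Lemma leq_exp_chain N X Y P Q n : N ^ P <= X ^ Q -> X ^ n.+1 <= Y ^ n ->
  N ^ (P * n.+1) <= Y ^ (Q * n).
Proof.
move=> NX XY; rewrite expnM; apply: leq_trans (leq_exp_base n.+1 NX) _.
by rewrite -expnM mulnC expnM [Q * n]mulnC [Y ^ _]expnM leq_exp_base.
Qed.

(** * Iterating the growth step *)

Section Iteration.
Variables (gT : finGroupType) (K : nat).
Implicit Types A : {set gT}.

Lemma iterate_growth k e n : 0 < k -> 0 < e ->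
    (forall A, sym_gen A -> K <= #|A| ->
      (A ^+ e)%g = [set: gT] \/ #|A| ^ n.+1 <= #|(A ^+ k)%g| ^ n) ->
  forall A, sym_gen A -> K <= #|A| -> forall i,
    (A ^+ (e * k ^ i))%g = [set: gT] \/
    #|A| ^ (n.+1 ^ i) <= #|(A ^+ (k ^ i))%g| ^ (n ^ i).
Proof.
move=> k0 e0 step A sA KA; elim=> [|i [IHi|IHi]]; first by right.
  left; apply/eqP; rewrite eqEsubset subsetT -IHi; case: sA => _ A1 _.
  by apply: expg_sub_leq; rewrite // leq_mul2l expnS leq_pmull ?orbT.
have ki0 : 0 < k ^ i by rewrite expn_gt0 k0.
have sAi := sym_gen_expg ki0 sA.
have KAi : K <= #|(A ^+ (k ^ i))%g|.
  by apply: leq_trans KA _; apply/subset_leq_card/sub_expg => //; case: sA.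
case: (step _ sAi KAi) => [E|E].
  left; apply/eqP; rewrite eqEsubset subsetT -E -expgM mulnC; case: sA => _ A1 _.
  by apply: expg_sub_leq; rewrite // leq_mul2l expnS leq_pmull ?orbT.
right; have := leq_exp_chain IHi E.
by rewrite -expgM -!expnSr.
Qed.

Lemma double_growth k e n : 0 < k -> 0 < e -> 0 < n ->
    (forall A, sym_gen A -> K <= #|A| ->
      (A ^+ e)%g = [set: gT] \/ #|A| ^ n.+1 <= #|(A ^+ k)%g| ^ n) ->
  forall A, sym_gen A -> K <= #|A| ->
    (A ^+ (e * k ^ n))%g = [set: gT] \/ #|A| ^ 2 <= #|(A ^+ (e * k ^ n))%g|.
Proof.
move=> k0 e0 n0 step A sA KA.
case: (iterate_growth k0 e0 step sA KA n) => [->|E]; first by left.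
have [_ A1 _] := sA; have A0 : 0 < #|A| by apply/card_gt0P; exists 1%g.
right; apply: leq_trans (_ : #|(A ^+ (k ^ n))%g| <= _); last first.
  by apply/subset_leq_card/expg_sub_leq => //; rewrite leq_pmull.
rewrite -(leq_exp2r _ _ (_ : 0 < n ^ n)) ?expn_gt0 ?n0 //.
apply: leq_trans E; rewrite -expnM leq_pexp2l //.
apply: leq_trans (leq_expS_mul n n); rewrite -[n in n * _ ^ _.-1]/n.
by rewrite -[n * _]expnS prednK // mul2n addnn.
Qed.

Lemma iterate_doubling m : 0 < m ->
    (forall A, sym_gen A -> K <= #|A| ->
      (A ^+ m)%g = [set: gT] \/ #|A| ^ 2 <= #|(A ^+ m)%g|) ->
  forall A, sym_gen A -> K <= #|A| -> forall i,
    (A ^+ (m ^ i))%g = [set: gT] \/ #|A| ^ (2 ^ i) <= #|(A ^+ (m ^ i))%g|.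
Proof.
move=> m0 step A sA KA i; have [_ A1 _] := sA.
elim: i => [|i [IHi|IHi]]; first by right.
  left; apply/eqP; rewrite eqEsubset subsetT -IHi.
  by apply: expg_sub_leq; rewrite // expnS leq_pmull.
have mi0 : 0 < m ^ i by rewrite expn_gt0 m0.
have KAi : K <= #|(A ^+ (m ^ i))%g|.
  by apply: leq_trans KA _; apply/subset_leq_card/sub_expg.
case: (step _ (sym_gen_expg mi0 sA) KAi); rewrite -expgM -expnSr => E; first by left.
by right; apply: leq_trans E; rewrite expnSr expnM leq_exp2r.
Qed.

(** The [K]-th power has more than [K >= 2] elements unless it is everything. After [j] squarings of
    the cardinality there would be at least [2 ^ (2 ^ j)] elements, more than the group has as soon
    as [2 ^ j >= 3 l]. *)
Lemma diameter_of_doubling c q : 1 < K ->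
    (forall A, sym_gen A -> K <= #|A| ->
      (A ^+ (2 ^ c))%g = [set: gT] \/ #|A| ^ 2 <= #|(A ^+ (2 ^ c))%g|) ->
    #|gT| <= q ^ 3 ->
  forall A l, sym_gen A -> 0 < l -> q < 2 ^ l ->
    (A ^+ (K * (8 * l) ^ c))%g = [set: gT].
Proof.
move=> K1 step Gq A l sA l0 ql; have [genA A1 _] := sA.
have mono u v (B : {set gT}) : 1%g \in B -> u <= v ->
    (B ^+ u)%g = [set: gT] -> (B ^+ v)%g = [set: gT].
  by move=> B1 uv E; apply/eqP; rewrite eqEsubset subsetT -E expg_sub_leq.
case: (expg_grow K genA A1) => [E|AK].
  by apply: mono E => //; rewrite leq_pmulr // expn_gt0 muln_gt0 l0.
(* Adding 3 to the logarithm gives [4 l < 2 ^ j <= 8 l]. *)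
have sAK := sym_gen_expg (ltnW K1) sA; pose j := (trunc_log 2 l).+3.
have /andP[j1 j2] := trunc_log_bounds (isT : 1 < 2) l0.
have c0 : 0 < 2 ^ c by rewrite expn_gt0.
case: (iterate_doubling c0 step sAK (ltnW AK) j); rewrite -!expgM.
  apply: mono => //; rewrite leq_mul2l -expnM mulnC expnM leq_exp_base ?orbT //.
  by rewrite /j !expnS; move: j1; lia.
move=> big; have : 2 ^ (2 ^ j) < 2 ^ (l * 3).
  apply: leq_ltn_trans (_ : #|(A ^+ K)%g| ^ (2 ^ j) < _).
    by apply: leq_exp_base; apply: leq_trans K1 (ltnW AK).
  apply: leq_ltn_trans big _; apply: leq_ltn_trans (max_card _) _.
  by apply: leq_ltn_trans Gq _; rewrite expnM ltn_exp2r.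
by rewrite ltn_exp2l // /j; move: j2; rewrite !expnS; lia.
Qed.
End Iteration.

(** The first bound is raised to the power 6 and weakened. The second is raised to the power 11 and
    multiplied by the sixth power of [M^4 <= 4 q^11]: then [q^66] cancels, [M^55] loses [M^24], and
    [4^6] is absorbed in [c^6]. *)
Lemma growth_arith N M q c : 0 < N -> N <= M -> 4 <= c ->
    M ^ 4 <= 4 * q ^ 11 ->
    N ^ 6 <= c * M ^ 5 \/ N ^ 3 * q ^ 6 <= c * M ^ 5 ->
  N ^ 33 <= c ^ 17 * M ^ 31.
Proof.
move=> N0 NM c4 Mq [E|E].
  have := leq_exp_base 6 E; rewrite expnMn -!expnM /= => E6.
  apply: leq_trans (_ : N ^ (6 * 6) <= _); first by rewrite leq_pexp2l.
  apply: leq_trans E6 _; apply: leq_mul; rewrite leq_pexp2l //.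
    by apply: leq_trans c4.
  by apply: leq_trans NM.
have := leq_mul (leq_exp_base 11 E) (leq_exp_base 6 Mq).
rewrite (expnMn (N ^ 3)) (expnMn c) (expnMn 4) -!expnM.
rewrite (_ : 6 * 11 = 11 * 6) // (_ : 5 * 11 = 31 + 4 * 6) // (expnD M).
have M0 : 0 < M ^ (4 * 6) by rewrite expn_gt0 (leq_trans N0 NM).
have [q0|q0] := posnP q.
  move: Mq; rewrite q0 !exp0n // muln0 leqn0 expn_eq0 /=.
  by rewrite -leqn0 leqNgt (leq_trans N0 NM).
have Q0 : 0 < q ^ (11 * 6) by rewrite expn_gt0 q0.
have C : c ^ 11 * 4 ^ 6 <= c ^ 17.
  by rewrite (_ : 17 = 11 + 6) // expnD leq_mul2l leq_exp_base ?orbT.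
have gen n Q m24 c11 m31 c6 c17 : 0 < Q -> 0 < m24 -> c11 * c6 <= c17 ->
    n * Q * m24 <= c11 * (m31 * m24) * (c6 * Q) -> n <= c17 * m31.
  move=> Qp mp cc H; rewrite -(leq_pmul2r mp) -(leq_pmul2r Qp).
  have -> : n * m24 * Q = n * Q * m24 by lia.
  apply: leq_trans H _.
  have -> : c11 * (m31 * m24) * (c6 * Q) = c11 * c6 * (m31 * m24 * Q) by lia.
  have -> : c17 * m31 * m24 * Q = c17 * (m31 * m24 * Q) by lia.
  by rewrite leq_mul2r cc orbT.
exact: gen.
Qed.

(* [24] is the power used in [growth_dichotomy], and [960 = 24 * 40]. *)
Lemma growth : exists K : nat, forall (F : finFieldType) (gT : finGroupType)
    (co : sl2_coords F gT) (A : {set gT}), sym_gen A -> K <= #|A| ->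
  (A ^+ 960)%g = [set: gT] \/ #|A| ^ 32 <= #|(A ^+ 24)%g| ^ 31.
Proof.
have above u v w : exists c, [/\ u <= c, v <= c & w <= c].
  by exists (u + v + w); split; lia.
have [c [c22 c32 c4]] := above (2 ^ 22) (2 ^ 32) 82.
have c17 : 82 <= c ^ 17.
  by apply: (leq_trans c4); rewrite -[X in X <= _]expn1 leq_pexp2l // (leq_trans _ c4).
exists (c ^ 17) => F gT co A sA KA; have [genA A1 AV] := sA.
have [big|small] := ltnP (4 * #|F| ^ 11) (#|(A ^+ 24)%g| ^ 4).
  left; have := cover_all co (expg_symm 24 AV) (expg_one_mem 24 A1) big.
  by rewrite -expgM.
right; have N81 := leq_trans c17 KA.
have NM : #|A| <= #|(A ^+ 24)%g| by apply/subset_leq_card/sub_expg.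
have N0 : 0 < #|A| by apply: leq_trans N81.
have : #|A| ^ 33 <= c ^ 17 * #|(A ^+ 24)%g| ^ 31.
  apply: (growth_arith N0 NM _ small); first by apply: leq_trans c4.
  case: (growth_dichotomy co genA A1 AV N81) => E; [left | right].
    by apply: leq_trans E _; rewrite leq_mul2r c22 orbT.
  by apply: leq_trans E _; rewrite leq_mul2r c32 orbT.
(* One of the 33 factors [|A|] pays for the constant [c ^ 17]. *)
move=> H; have := leq_trans H (leq_mul KA (leqnn _)).
by rewrite (expnS _ 32) leq_pmul2l.
Qed.

Lemma diameter : exists K c : nat, forall (F : finFieldType) (gT : finGroupType)
    (co : sl2_coords F gT) (A : {set gT}) (l : nat),
  sym_gen A -> 0 < l -> #|F| < 2 ^ l -> (A ^+ (K * (8 * l) ^ c))%g = [set: gT].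
Proof.
have [K step] := growth.
have [m [m0 dbl]] : exists m, 0 < m /\ forall (F : finFieldType) (gT : finGroupType)
    (co : sl2_coords F gT) (A : {set gT}), sym_gen A -> K.+2 <= #|A| ->
  (A ^+ m)%g = [set: gT] \/ #|A| ^ 2 <= #|(A ^+ m)%g|.
  (* Variable exponents keep the number 960 * 24 ^ 31 unevaluated. *)
  suff gen e k n : 0 < e -> 0 < k -> 0 < n -> (forall (F : finFieldType)
      (gT : finGroupType) (co : sl2_coords F gT) (A : {set gT}), sym_gen A -> K <= #|A| ->
      (A ^+ e)%g = [set: gT] \/ #|A| ^ n.+1 <= #|(A ^+ k)%g| ^ n) -> exists m, 0 < m /\
      forall (F : finFieldType) (gT : finGroupType) (co : sl2_coords F gT)
        (A : {set gT}), sym_gen A -> K.+2 <= #|A| ->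
      (A ^+ m)%g = [set: gT] \/ #|A| ^ 2 <= #|(A ^+ m)%g|.
    exact: (gen 960 24 31 isT isT isT step).
  move=> e0 k0 n0 {}step; exists (e * k ^ n); split=> [|F gT co].
    by rewrite muln_gt0 e0 expn_gt0 k0.
  apply: double_growth => // A sA KA; apply: (step F gT co A sA).
  by apply: leq_trans KA; rewrite -addn2 leq_addr.
exists K.+2, m => F gT co A l sA l0 ql.
apply: (diameter_of_doubling (q := #|F|) (K := K.+2)) => //; last exact: card_sl2_leq co.
(* [diameter_of_doubling] wants a power of two; [m <= 2 ^ m] supplies one. *)
move=> B sB KB; have [_ B1 _] := sB; have mm := ltnW (ltn_expl m (isT : 1 < 2)).
case: (dbl F gT co B sB KB) => E; [left | right].
  by apply/eqP; rewrite eqEsubset subsetT -E expg_sub_leq.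
by apply: leq_trans E _; apply/subset_leq_card/expg_sub_leq.
Qed.

(** * The second eigenvalue *)

Local Open Scope ring_scope.

Section SecondEigenvalue.
Variable R : realType.

Lemma char_poly_similar n (P Q M : 'M[R]_n) :
  Q *m P = 1%:M -> char_poly (Q *m M *m P) = char_poly M.
Proof.
move=> QP; rewrite /char_poly.
have -> : char_poly_mx (Q *m M *m P) =
    map_mx polyC Q *m char_poly_mx M *m map_mx polyC P.
  rewrite /char_poly_mx mulmxBr mulmxBl -!map_mxM; congr (_ - _).
  by rewrite mul_mx_scalar -scalemxAl -map_mxM QP map_mx1 scalemx1.
rewrite !det_mulmx mulrAC -det_mulmx -map_mxM QP map_mx1 det1 mul1r //.
Qed.

Lemma char_poly_ublock m n (A : 'M[R]_m) B (D : 'M[R]_n) :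
  char_poly (block_mx A B 0 D) = char_poly A * char_poly D.
Proof.
rewrite /char_poly /char_poly_mx map_block_mx scalar_mx_block opp_block_mx.
by rewrite add_block_mx map_mx0 oppr0 addr0 det_ublock.
Qed.

(* In a basis starting with the all-ones vector, [M] is block triangular. *)
Lemma stochastic_char_poly n (M : 'M[R]_n.+1) :
    M *m const_mx 1 = const_mx 1 :> 'cV_n.+1 ->
  exists Q : 'M[R]_n, char_poly M = ('X - 1%:P) * char_poly Q /\
    forall r, root (char_poly Q) r ->
      exists2 v : 'rV_n.+1, v != 0 & v *m M = r *: v /\ v *m const_mx 1 = 0 :> 'M_1.
Proof.
rewrite -[n.+1]/(1 + n)%N in M *; move=> M1.
pose one : 'cV[R]_n := const_mx 1.
pose P : 'M[R]_(1 + n) := block_mx 1%:M 0 one 1%:M.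
pose P' : 'M[R]_(1 + n) := block_mx 1%:M 0 (- one) 1%:M.
have P'P : P' *m P = 1%:M.
  rewrite mulmx_block !mul1mx !mul0mx !mulmx1 !mulmx0 !addr0 addNr add0r.
  by rewrite -scalar_mx_block.
have PP' := mulmx1C P'P.
pose e0 : 'M[R]_(1 + n, 1) := col_mx 1%:M 0.
have Pe : P *m e0 = const_mx 1.
  rewrite mul_block_col !mul1mx !mul0mx mulmx1 !addr0.
  rewrite -[RHS]vsubmxK; congr col_mx; apply/matrixP => i j; rewrite !mxE //.
  by rewrite !ord1 eqxx.
pose Z := P' *m M *m P.
have Ze : Z *m e0 = e0.
  by rewrite /Z -mulmxA Pe -mulmxA M1 -Pe mulmxA P'P mul1mx.
have Zb : Z = block_mx 1%:M (ursubmx Z) 0 (drsubmx Z).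
  rewrite -[LHS]submxK; move: Ze; rewrite -{1}[Z]submxK mul_block_col.
  by rewrite !mulmx1 !mulmx0 !addr0 => /eq_col_mx[-> ->].
exists (drsubmx Z); split.
  rewrite -(char_poly_similar M P'P) -/Z {1}Zb char_poly_ublock; congr (_ * _).
  by rewrite /char_poly /char_poly_mx map_scalar_mx -raddfB /= det_scalar1.
move=> r; rewrite -eigenvalue_root_char => /eigenvalueP[u uQ u0].
have vP : row_mx 0 u *m P' *m P = row_mx 0 u by rewrite -mulmxA P'P mulmx1.
(* A left eigenvector of the lower block, padded by 0 and carried back to the old basis; it kills
   the all-ones vector because [P'] maps that vector to [e0]. *)
exists (row_mx 0 u *m P').
  apply: contraNneq u0 => v0; move: vP; rewrite v0 mul0mx => /esym/eqP.
  by rewrite row_mx_eq0 => /andP[].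
split; last by rewrite -Pe mulmxA vP mul_row_col mul0mx mulmx0 addr0.
have uZ : row_mx 0 u *m Z = r *: row_mx 0 u.
  rewrite {1}Zb mul_row_block !mul0mx mulmx0 !add0r uQ.
  by rewrite scale_row_mx scaler0.
have MP : P' *m M = Z *m P' by rewrite /Z -mulmxA PP' mulmx1.
by rewrite -mulmxA MP mulmxA uZ scalemxAl.
Qed.

Lemma count_flatten_nseq (T : eqType) (f : T -> nat) (s : seq T) x : uniq s ->
  count_mem x (flatten [seq nseq (f y) y | y <- s]) = if x \in s then f x else 0%N.
Proof.
elim: s => //= y s IHs /andP[ys us]; rewrite count_cat count_nseq IHs // inE /=.
have [yx|yx] := eqVneq y x; last by rewrite mul0n.
by rewrite -yx (negPf ys) mul1n addn0.
Qed.

(** All roots of [q] are at most [be < 1], so 1 is a simple root of the characteristic polynomial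
    and occupies only one place of the sorted list. *)
Lemma second_largest_leq n (M : 'M[R]_n) (q : {poly R}) (be : R) :
    char_poly M = ('X - 1%:P) * q -> q != 0 -> 0 <= be -> be < 1 ->
    (forall r, root q r -> r <= be) ->
  second_largest_eigenvalue M <= be.
Proof.
move=> Mq q0 be0 be1 qbe; rewrite /second_largest_eigenvalue.
have p0 : char_poly M != 0 by rewrite monic_neq0 // char_poly_monic.
pose s := flatten [seq nseq (mup x (char_poly M)) x | x <- rootsR (char_poly M)].
have sE : eigenvalues M = sort (fun x y => y <= x) s by [].
have cs x : count_mem x s = if x \in rootsR (char_poly M) then mup x (char_poly M) else 0%N.
  by apply: count_flatten_nseq; apply: uniq_roots.
have one : (count_mem 1%R s <= 1)%N.
  rewrite cs; case: ifP => // _; rewrite Mq mupMl ?(@mup_XsubCX _ 1) ?eqxx //.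
  by apply/negP => /qbe; rewrite leNgt be1.
have s1 x : x \in s -> x = 1 \/ x <= be.
  rewrite -has_pred1 has_count cs; case: ifP => // _.
  rewrite -XsubC_dvd // dvdp_XsubCl Mq rootM root_XsubC => /orP[/eqP|/qbe]; first by left.
  by right.
(* With fewer than two real eigenvalues, [nth] returns the default 0, which is at most [be]. *)
have [small|big] := ltnP 1 (size (eigenvalues M)); last by rewrite nth_default.
have srt : sorted (fun x y => y <= x) (eigenvalues M).
  by rewrite sE; apply: sort_sorted => x y; apply: le_total.
have memE x : (x \in eigenvalues M) = (x \in s) by rewrite sE mem_sort.
have cE : count_mem 1 (eigenvalues M) = count_mem 1 s.
  by rewrite sE count_sort.
move: small srt memE cE; case: (eigenvalues M) => [//|x [//|y t]] _ /= /andP[yx _] memE cE.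
have ys : y \in s by rewrite -memE !inE eqxx orbT.
have xs : x \in s by rewrite -memE !inE eqxx.
case: (s1 _ ys) => // y1; case: (s1 _ xs) => x1.
  by move: one; rewrite -cE x1 y1 eqxx.
by move: yx; rewrite y1 leNgt (le_lt_trans x1 be1).
Qed.
End SecondEigenvalue.

(** * Dirichlet forms along words in the generators *)

Section SpectralGap.
Variables (R : realType) (gT : finGroupType) (psi : gT -> R) (A : {set gT}).
Hypotheses (psiD : is_distribution psi) (psiS : symmetric_fun psi).
Let eta := min_weight psi A.
Let S := (1%g |: (A :|: A^-1%g))%g.

Let psi_ge0 g : 0 <= psi g. Proof. by case: psiD => H _. Qed.
Let psi1 : \sum_g psi g = 1. Proof. by case: psiD. Qed.

Lemma min_weight_ge0 : 0 <= eta.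
Proof. by apply: (big_ind (fun x => 0 <= x)) => // x y x0 y0; rewrite le_min x0. Qed.

Lemma min_weight_leq g : g \in (A :|: A^-1)%g -> eta <= psi g.
Proof. by move=> gA; apply: bigmin_le_cond. Qed.

Lemma min_weight_leq1 : eta <= 1.
Proof. exact: bigmin_le_id. Qed.

Lemma sum_psi_row y : \sum_x psi (y^-1 * x)%g = 1.
Proof. by rewrite -[RHS]psi1 [RHS](reindex_inj (mulgI y^-1)%g). Qed.

Lemma sum_psi_col x : \sum_y psi (y^-1 * x)%g = 1.
Proof.
rewrite -(sum_psi_row x); apply: eq_bigr => y _.
by rewrite psiS invMg invgK.
Qed.

Section Eigenfunction.
Variables (f : gT -> R) (r : R).
Hypothesis eig : forall y, \sum_x f x * psi (y^-1 * x)%g = r * f y.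

Let nrm := \sum_y f y ^+ 2.
Let Delta g := \sum_y (f y - f (y * g)%g) ^+ 2.

(** Expanding the square, the two diagonal terms each give [nrm] because rows and columns sum to 1,
    and the cross term is evaluated by the eigenvalue equation. *)
Lemma dirichlet : \sum_s psi s * Delta s = 2 * (1 - r) * nrm.
Proof.
have -> : \sum_s psi s * Delta s = \sum_y \sum_x psi (y^-1 * x)%g * (f y - f x) ^+ 2.
  rewrite /Delta; under eq_bigr do rewrite mulr_sumr.
  rewrite exchange_big /=; apply: eq_bigr => y _.
  by rewrite [RHS](reindex_inj (mulgI y)) /=; apply: eq_bigr => s _; rewrite mulKg.
have -> : \sum_y \sum_x psi (y^-1 * x)%g * (f y - f x) ^+ 2 =
    \sum_y \sum_x f y ^+ 2 * psi (y^-1 * x)%g +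
    \sum_y \sum_x f x ^+ 2 * psi (y^-1 * x)%g -
    2 * \sum_y \sum_x f y * (f x * psi (y^-1 * x)%g).
  rewrite -big_split mulr_sumr -sumrB /=; apply: eq_bigr => y _.
  rewrite -big_split mulr_sumr -sumrB /=; apply: eq_bigr => x _.
  by ring.
rewrite [\sum_y \sum_x f x ^+ 2 * _]exchange_big /=.
under eq_bigr do rewrite -mulr_sumr sum_psi_row mulr1.
under [X in _ + X - _]eq_bigr do rewrite -mulr_sumr sum_psi_col mulr1.
under [X in _ - 2 * X]eq_bigr do rewrite -mulr_sumr eig mulrCA -expr2.
by rewrite -mulr_sumr -/nrm; ring.
Qed.

Lemma Delta_ge0 g : 0 <= Delta g.
Proof. by apply: sumr_ge0 => y _; apply: sqr_ge0. Qed.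

Lemma Delta1 : Delta 1%g = 0.
Proof. by rewrite /Delta big1 // => y _; rewrite mulg1 subrr expr0n. Qed.

Let E := 2 * (1 - r) * nrm.

Lemma E_ge0 : 0 <= E.
Proof. by rewrite /E -dirichlet; apply: sumr_ge0 => s _; rewrite mulr_ge0 ?Delta_ge0. Qed.

Lemma Delta_gen s : s \in S -> eta * Delta s <= E.
Proof.
rewrite /S in_setU1 => /predU1P[->|sA]; first by rewrite Delta1 mulr0 E_ge0.
apply: le_trans (_ : psi s * Delta s <= _).
  by rewrite ler_wpM2r ?Delta_ge0 // min_weight_leq.
rewrite /E -dirichlet (bigD1 s) //= lerDl; apply: sumr_ge0 => t _.
by rewrite mulr_ge0 ?Delta_ge0.
Qed.

(** The square root of [Delta] is an l2 distance between [f] and a right translate, hence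
    subadditive along words; each letter contributes at most the square root of [E / eta]. *)
Lemma Delta_word n g : g \in (S ^+ n)%g -> eta * Delta g <= n%:R ^+ 2 * E.
Proof.
elim: n g => [|n IHn] g.
  by rewrite expg0 => /set1P ->; rewrite Delta1 mulr0 mulr_ge0 ?sqr_ge0 ?E_ge0.
rewrite expgSr => /mulsgP[g' s g'S sS ->].
(* The weighted inequality below is multiplied by [n], so words of one letter are treated apart. *)
have [n0|n0] := posnP n.
  move: g'S; rewrite n0 expg0 => /set1P ->.
  by rewrite mul1g expr1n mul1r Delta_gen.
have nR : 0 < n%:R :> R by rewrite ltr0n.
have shift : \sum_y (f (y * g')%g - f (y * g' * s)%g) ^+ 2 = Delta s.
  by rewrite /Delta [RHS](reindex_inj (mulIg g')).
(* [(a + b)^2 <= (n + 1) a^2 + (1 + 1/n) b^2], multiplied by [n]. *)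
have split_le : n%:R * Delta (g' * s)%g <=
    n%:R * (n%:R + 1) * Delta s + (n%:R + 1) * Delta g'.
  rewrite -shift /Delta !mulr_sumr -big_split /=; apply: ler_sum => y _.
  rewrite mulgA; set u := f y; set v := f (y * g')%g; set w := f _.
  rewrite -subr_ge0; set X := (X in 0 <= X).
  have -> : X = (n%:R * (v - w) - (u - v)) ^+ 2 by rewrite /X; ring.
  exact: sqr_ge0.
have := IHn _ g'S; have := Delta_gen sS; have eta0 := min_weight_ge0.
move=> H1 H2; rewrite -(ler_pM2l nR).
apply: le_trans (_ : eta * (n%:R * (n%:R + 1) * Delta s + (n%:R + 1) * Delta g') <= _).
  by rewrite mulrCA ler_wpM2l.
have -> : n%:R * (n.+1%:R ^+ 2 * E) =
    n%:R * (n%:R + 1) * E + (n%:R + 1) * (n%:R ^+ 2 * E) by rewrite -natr1; ring.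
have -> : eta * (n%:R * (n%:R + 1) * Delta s + (n%:R + 1) * Delta g') =
    n%:R * (n%:R + 1) * (eta * Delta s) + (n%:R + 1) * (eta * Delta g') by ring.
by apply: lerD; apply: ler_wpM2l => //; rewrite ?mulr_ge0 ?addr_ge0 ?ltW.
Qed.

Lemma sum_Delta : \sum_y f y = 0 -> \sum_g Delta g = 2 * #|gT|%:R * nrm.
Proof.
move=> f0.
have -> : \sum_g Delta g = \sum_y \sum_x (f y - f x) ^+ 2.
  rewrite /Delta exchange_big /=; apply: eq_bigr => y _.
  by rewrite [RHS](reindex_inj (mulgI y)).
have inner y : \sum_x (f y - f x) ^+ 2 = #|gT|%:R * f y ^+ 2 + nrm - 2 * f y * \sum_x f x.
  have -> : #|gT|%:R * f y ^+ 2 = \sum_(x : gT) f y ^+ 2 by rewrite sumr_const mulr_natl.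
  rewrite mulr_sumr -big_split -sumrB /=; apply: eq_bigr => x _.
  by ring.
under eq_bigr do rewrite inner f0 mulr0 subr0.
rewrite big_split /= -mulr_sumr -/nrm sumr_const -mulr_natl.
by rewrite (_ : #|_| = #|gT|) //; ring.
Qed.

(** Summing [Delta_word] over the group, the left side becomes the variance of [f] by [sum_Delta],
    and [2 |G| nrm] cancels. *)
Lemma eigenvalue_gap d : (S ^+ d)%g = [set: gT] -> \sum_y f y = 0 ->
  (exists y, f y != 0) -> eta <= d%:R ^+ 2 * (1 - r).
Proof.
move=> Sd f0 [y0 fy0].
have nrm_gt0 : 0 < nrm.
  rewrite /nrm (bigD1 y0) //= ltr_pwDl ?exprn_even_gt0 //.
  by apply: sumr_ge0 => y _; apply: sqr_ge0.
have card_gt0 : 0 < #|gT|%:R :> R by rewrite ltr0n; apply/card_gt0P; exists y0.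
have : eta * (\sum_g Delta g) <= \sum_(g : gT) d%:R ^+ 2 * E.
  rewrite mulr_sumr; apply: ler_sum => g _; apply: Delta_word.
  by rewrite Sd inE.
rewrite (sum_Delta f0) sumr_const -[X in _ <= X]mulr_natl /E => H.
have c0 : 0 < 2 * #|gT|%:R * nrm by rewrite !mulr_gt0.
rewrite -(ler_pM2r c0); apply: le_trans H _.
by rewrite le_eqVlt; apply/orP; left; apply/eqP; ring.
Qed.
End Eigenfunction.

Lemma second_eigenvalue_gap d (be : R) : (S ^+ d)%g = [set: gT] ->
    0 <= be -> be < 1 -> (forall r, eta <= d%:R ^+ 2 * (1 - r) -> r <= be) ->
  second_largest_eigenvalue (transition_matrix psi) <= be.
Proof.
move=> Sd be0 be1 gap; set M := transition_matrix psi.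
have M1 : M *m const_mx 1 = const_mx 1 :> 'cV_#|gT|.
  apply/matrixP => i j; rewrite !mxE -[RHS](sum_psi_col (enum_val i)).
  rewrite [RHS](reindex_onto enum_val enum_rank) /= => [|y _]; last exact: enum_rankK.
  apply: eq_big => [k|k _]; first by rewrite enum_valK eqxx.
  by rewrite !mxE mulr1.
have [Q [Mq Qroot]] : exists Q : 'M[R]_#|gT|.-1, char_poly M = ('X - 1%:P) * char_poly Q /\
    forall r, root (char_poly Q) r ->
      exists2 v : 'rV_#|gT|, v != 0 & v *m M = r *: v /\ v *m const_mx 1 = 0 :> 'M_1.
  have : (0 < #|gT|)%N by apply/card_gt0P; exists 1%g.
  by move: M M1; case: #|gT| => // n M M1 _; apply: stochastic_char_poly.
apply: (second_largest_leq Mq) => //; first by rewrite monic_neq0 // char_poly_monic.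
move=> r /Qroot[v v0 [vM v1]]; apply: gap.
pose f x := v 0 (enum_rank x).
have sumE (F : gT -> R) : \sum_x F x = \sum_(i < #|gT|) F (enum_val i).
  rewrite (reindex_onto enum_val enum_rank) /= => [|y _]; last exact: enum_rankK.
  by apply: eq_big => [k|//]; rewrite enum_valK eqxx.
apply: (@eigenvalue_gap f r) Sd _ _ => [y||].
- have /matrixP/(_ 0 (enum_rank y)) := vM; rewrite !mxE => <-; rewrite sumE.
  by apply: eq_bigr => i _; rewrite /f !mxE enum_valK enum_rankK.
- have /matrixP/(_ 0 0) := v1; rewrite !mxE => v10; rewrite -[RHS]v10 sumE.
  by apply: eq_bigr => i _; rewrite /f !mxE enum_valK mulr1.
have /rV0Pn[i vi] := v0; exists (enum_val i).
by rewrite /f enum_valK.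
Qed.
End SpectralGap.

(** * The special linear groups over prime fields *)

Section SL2Coordinates.
Variable p : nat.
Local Notation mx x := (GLval (sgval (x : SL2 p))).

Lemma SL2_mxM (x y : SL2 p) : mx (x * y)%g = mx x *m mx y.
Proof. by rewrite sgvalM ?inE // GL_ME. Qed.

Lemma SL2_mx_inj : injective (fun x : SL2 p => mx x).
Proof. by move=> x y E; apply: subg_inj; apply: val_inj. Qed.

Lemma det_mx2 (F : comNzRingType) (M : 'M[F]_2) : \det M = M 0 0 * M 1 1 - M 0 1 * M 1 0.
Proof.
rewrite (expand_det_row _ 0) !big_ord_recl big_ord0 addr0 /cofactor !det_mx11 !mxE /=.
rewrite expr0 mul1r expr1 mulN1r mulrN; congr (_ * M _ _ - M _ _ * M _ _); exact: val_inj.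
Qed.

Lemma SL2_mx_det (x : SL2 p) : \det (mx x) = 1.
Proof. by case: x => x /=; rewrite inE => /eqP. Qed.

Lemma SL2_mx_surj (m : 'M['F_p]_2) : \det m = 1 -> exists x : SL2 p, mx x = m.
Proof.
move=> m1; have um : m \in unitmx by rewrite unitmxE m1 unitr1.
have um' : (m : 'M['F_p]_(2.-1.+1)) \is a GRing.unit := um.
pose u : {'GL_2['F_p]} := FinRing.Unit um'.
have uS : u \in SL2_group p by rewrite inE; apply/eqP.
by exists (subg (SL2_group p) u); rewrite subgK.
Qed.

Lemma SL2_mxE (x y : SL2 p) (i j : 'I_2) :
  mx (x * y)%g i j = mx x i 0 * mx y 0 j + mx x i 1 * mx y 1 j.
Proof.
rewrite SL2_mxM mxE !big_ord_recl big_ord0 addr0.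
by congr (_ * _ + mx _ _ _ * mx _ _ _); apply: val_inj.
Qed.

Definition SL2_coords (two0 : (2 : 'F_p) != 0) : sl2_coords 'F_p (SL2 p).
Proof.
refine (@Sl2Coords 'F_p (SL2 p) (fun x => mx x 0 0) (fun x => mx x 0 1)
  (fun x => mx x 1 0) (fun x => mx x 1 1) _ _ _ _ _ _ _ two0).
- by move=> g; have := SL2_mx_det g; rewrite det_mx2 => /eqP; rewrite subr_eq => /eqP.
- by move=> g h; rewrite SL2_mxE.
- by move=> g h; rewrite SL2_mxE.
- by move=> g h; rewrite SL2_mxE.
- by move=> g h; rewrite SL2_mxE.
- move=> g h e00 e01 e10 e11; apply: SL2_mx_inj; apply/matrixP => i j.
  have ord2 (k : 'I_2) : k = 0 \/ k = 1.
    by case: k => [[|[|//]] ?]; [left | right]; apply: val_inj.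
  by case: (ord2 i) => ->; case: (ord2 j) => ->.
move=> a b c d E.
pose m : 'M['F_p]_2 := \matrix_(i, j) (if i == 0 then if j == 0 then a else b
                                       else if j == 0 then c else d).
have m1 : \det m = 1 by rewrite det_mx2 !mxE /= E addrK.
by have [x mx_x] := SL2_mx_surj m1; exists x; rewrite mx_x !mxE.
Defined.

Lemma card_SL2_leq : (#|SL2 p| <= #|'F_p| ^ 4)%N.
Proof.
have -> : (#|'F_p| ^ 4 = #|{: 'M['F_p]_2}|)%N by rewrite card_mx.
by rewrite -[X in (_ <= X)%N]cardsT -cardsT; apply: card_inj_leq (in2W SL2_mx_inj).
Qed.
End SL2Coordinates.

(** For [p = 2] the group has at most 16 elements, which explains [K + 16]; the exponent is
    increased by one to be positive. *)
Lemma SL2_diameter : exists K k : nat, [/\ (0 < K)%N, (0 < k)%N &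
  forall (p : nat) (S : {set SL2 p}) (l : nat), prime p -> sym_gen S -> (0 < l)%N ->
    (p < 2 ^ l)%N -> (S ^+ (K * (8 * l) ^ k))%g = [set: SL2 p]].
Proof.
have [K [k diam]] := diameter; exists (K + 16)%N, k.+1; split; rewrite ?addn_gt0 ?orbT //.
move=> p S l pp sS l0 pl; have [genS S1 _] := sS.
have [two0|two0] := eqVneq (2 : 'F_p) 0.
  have p2 : p = 2.
    apply/eqP; rewrite -dvdn_prime2 // (dvdn_pcharf (pchar_Fp pp)).
    exact/eqP.
  have [//|big] := expg_grow ((K + 16) * (8 * l) ^ k.+1) genS S1.
  have := leq_trans big (leq_trans (max_card _) (card_SL2_leq p)).
  rewrite card_Fp // [X in (X ^ 4)%N]p2 ltnNge mulnDl; case/negP.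
  by apply: leq_trans (leq_addl _ _); rewrite leq_pmulr // expn_gt0 muln_gt0 l0.
have := diam _ _ (SL2_coords two0) S l sS l0; rewrite card_Fp // => /(_ pl) E.
apply/eqP; rewrite eqEsubset subsetT -E; apply: expg_sub_leq => //.
by apply: leq_mul; rewrite ?leq_addr // leq_pexp2l // muln_gt0 l0.
Qed.

Theorem corollary6p1 (R : realType) :
  exists c C : R, 0 < c /\ 0 < C /\
    forall (p : nat) (A : {set SL2 p}) (psi : SL2 p -> R),
      prime p ->
      <<A>>%g = [set: SL2 p] ->
      is_distribution psi ->
      symmetric_fun psi ->
      A \subset fun_support psi ->
      second_largest_eigenvalue (transition_matrix psi)
        <= 1 - C * min_weight psi A / (ln (p%:R : R)) `^ (2 * c).
Proof.
have [K [k [K0 k0 diam]]] := SL2_diameter.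
have ln2 : 0 < ln (2 : R) by apply: ln_gt0; rewrite ltr1n.
(* Chosen so that [d <= kap * L ^+ k]: [l <= 2 L / ln 2] gives [8 l <= 16 L / ln 2]. The gap
   [eta / d^2] then yields the witnesses [k] and [kap ^- 2]. *)
pose kap : R := K%:R * (16 / ln 2) ^+ k.
have kap0 : 0 < kap by rewrite mulr_gt0 ?ltr0n // exprn_gt0 // divr_gt0.
exists k%:R, (kap ^- 2); split; first by rewrite ltr0n.
split; first by rewrite invr_gt0 exprn_gt0.
move=> p A psi pp genA psiD psiS Apsi.
pose S := (1%g |: (A :|: A^-1%g))%g.
have sS : sym_gen S.
  split.
  - apply/eqP; rewrite eqEsubset subsetT -genA genS //.
    by apply/subsetP => x xA; rewrite !inE xA orbT.
  - by rewrite !inE eqxx.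
  by apply/setP => x; rewrite !inE invgK invg_eq1 [(x^-1%g \in A) || _]orbC.
have p1 : (1 < p)%N by apply: prime_gt1.
pose l := (trunc_log 2 p).+1.
have /andP[l1 l2] := trunc_log_bounds (isT : (1 < 2)%N) (ltnW p1).
pose d := (K * (8 * l) ^ k)%N.
have Sd : (S ^+ d)%g = [set: SL2 p] by apply: diam.
pose L := ln (p%:R : R).
have L0 : 0 < L by apply: ln_gt0; rewrite ltr1n.
(* As [p >= 2], the logarithm is at least 1, so [l] is at most twice it and [2 ^ l <= p ^ 2]. *)
have lL : l%:R <= 2 * L / ln 2.
  have t1 : (0 < trunc_log 2 p)%N by rewrite trunc_log_gt0 p1.
  rewrite ler_pdivlMr //.
  have -> : l%:R * ln 2 = ln ((2 : R) ^+ l) by rewrite lnXn // mulr_natl.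
  have -> : 2 * L = ln ((p%:R : R) ^+ 2) by rewrite lnXn ?mulr_natl // ltr0n prime_gt0.
  rewrite ler_ln ?posrE ?exprn_gt0 // ?ltr0n ?prime_gt0 // -!natrX ler_nat.
  apply: leq_trans (_ : 2 ^ (trunc_log 2 p * 2) <= _)%N.
    by rewrite leq_pexp2l // /l; lia.
  by rewrite expnM leq_exp2r.
have dL : d%:R <= kap * L ^+ k.
  rewrite /d /kap natrM natrX natrM -mulrA -exprMn ler_wpM2l //.
  apply: lerXn2r; rewrite ?nnegrE ?mulr_ge0 ?invr_ge0 ?(ltW L0) ?(ltW ln2) //.
  apply: le_trans (_ : 8 * (2 * L / ln 2) <= _); first by rewrite ler_wpM2l.
  by rewrite le_eqVlt; apply/orP; left; apply/eqP; field; rewrite gt_eqF.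
have d1 : 1 <= d%:R :> R by rewrite ler1n /d muln_gt0 K0 expn_gt0.
(* With [eta <= 1] this makes the bound [1 - eta / D] nonnegative. *)
have kL : 1 <= (kap * L ^+ k) ^+ 2 by rewrite exprn_ege1 // (le_trans d1).
have -> : ln p%:R `^ (2 * k%:R) = (L ^+ k) ^+ 2.
  by rewrite -natrM powR_mulrn ?ltW // mulnC exprM.
set eta := min_weight psi A.
have eta1 : eta <= 1 by apply: min_weight_leq1.
have eta0 : 0 < eta.
  rewrite /eta /min_weight; apply: (big_ind (fun x => 0 < x)) => //.
    by move=> x y x0 y0; rewrite lt_min x0.
  have supp x : x \in A -> 0 < psi x.
    move=> /(subsetP Apsi); rewrite inE => x0; rewrite lt_neqAle eq_sym x0.
    by case: psiD => ->.
  move=> x; rewrite !inE => /orP[/supp //|/supp]; by rewrite -psiS.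
set D := (kap * L ^+ k) ^+ 2 in kL.
have -> : kap ^- 2 * eta / (L ^+ k) ^+ 2 = eta / D.
  by rewrite /D (exprMn 2 kap) (invfM (kap ^+ 2)) [RHS]mulrCA mulrA.
have D0 : 0 < D by apply: lt_le_trans kL.
apply: (second_eigenvalue_gap psiD psiS Sd).
- by rewrite subr_ge0 ler_pdivrMr // mul1r (le_trans eta1).
- by rewrite ltrBlDr ltrDl divr_gt0.
move=> r gap; have d2 : d%:R ^+ 2 <= D.
  by apply: lerXn2r; rewrite ?nnegrE // (le_trans _ dL).
(* The sign of [1 - r] allows [d ^ 2] to be replaced by the larger [D]. *)
have r1 : 0 <= 1 - r.
  rewrite -(pmulr_rge0 _ (_ : 0 < d%:R ^+ 2)); first by apply: le_trans gap; apply: ltW.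
  by rewrite exprn_gt0 // (lt_le_trans _ d1).
rewrite lerBrDr addrC -lerBrDr ler_pdivrMr // mulrC.
by apply: le_trans gap _; rewrite ler_wpM2r.
Qed.
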